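(* Let $d\ge 2$ be an integer, let $A,B\in\mathbb{Q}[z]$ with $B\neq 0$, and let $f(z)\in\mathbb{Q}((z^{-1}))$ be a Laurent series satisfying the functional equation $$f(z)=\frac{A(z)}{B(z)}\,f(z^d).$$ Let $b\in\mathbb{Z}$ lie inside the domain of convergence of $f(z)$. Assume that $A(b^{d^m})B(b^{d^m})\neq 0$ for all integers $m\ge 0$ and that $f(b)$ is irrational. Then the irrationality exponent $\mu(f(b))$ is a rational number.
   Context: The irrationality exponent $\mu(\xi)$ of a real number $\xi$ is the supremum of the real numbers $\mu$ such that the inequality $|\xi-p/q|<q^{-\mu}$ has infinitely many rational solutions $p/q$. A Laurent series in $z^{-1}$ converges on a region of the form $|z|>R$; ''inside the domain of convergence'' means $b$ lies in this region. *)

(* Defs.v *)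
From HB Require Import structures.
From mathcomp Require Import all_boot all_order all_algebra.
From mathcomp Require Import all_classical all_reals all_analysis.

Set Implicit Arguments.
Unset Strict Implicit.
Unset Printing Implicit Defensive.

Import Order.TTheory GRing.Theory Num.Theory.
Import numFieldNormedType.Exports.

Local Open Scope classical_set_scope.
Local Open Scope ring_scope.

(* An element of Q((z^{-1})), split as Q[z] (+) z^{-1} Q[[z^{-1}]]:
   lpoly + \sum_(k >= 0) ltail k * z^{-(k+1)}. Every Laurent series in z^{-1}
   has exactly one such decomposition. *)
Record laurent := Laurent { lpoly : {poly rat}; ltail : nat -> rat }.

(* The coefficient of z^n; recall that Negz k is the integer -(k+1). *)
Definition lcoef (f : laurent) (n : int) : rat :=
  match n with
  | Posz i => (lpoly f)`_i
  | Negz k => ltail f k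
  end.

(* Coefficients of f(z^d), where c is the coefficient sequence of f. *)
Definition coef_comp_Xn (d : nat) (c : int -> rat) (n : int) : rat :=
  if (d%:Z %| n)%Z then c (n %/ d%:Z)%Z else 0.

(* Coefficients of P(z) f(z), where c is the coefficient sequence of f. *)
Definition coef_mul_poly (P : {poly rat}) (c : int -> rat) (n : int) : rat :=
  \sum_(i < size P) P`_i * c (n - i%:Z).

(* f(z) = A(z)/B(z) * f(z^d) in the field Q((z^{-1})). Dividing by B <> 0 in
   that field means that B(z) f(z) = A(z) f(z^d), and two Laurent series are
   equal when all their coefficients are. *)
Definition mahler_eq (d : nat) (A B : {poly rat}) (f : laurent) : Prop :=
  forall n : int,
    coef_mul_poly B (lcoef f) n = coef_mul_poly A (coef_comp_Xn d (lcoef f)) n.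

Section Evaluation.
Variable R : realType.
Implicit Types (f : laurent) (x : R).

Definition ltailR f (k : nat) : R := ratr (ltail f k).

(* Only meaningful for x <> 0, as 0^-1 = 0. *)
Definition lconverges f x : Prop := cvgn (pseries (ltailR f) x^-1).

Definition leval f x : R :=
  (map_poly ratr (lpoly f)).[x] + x^-1 * limn (pseries (ltailR f) x^-1).

(* x lies in the region |z| > r0, where r0 >= 0 is the radius of convergence;
   testing convergence at real points only gives the same r0 as testing it at
   all complex points. *)
Definition in_convergence_domain f x : Prop :=
  exists r : R,
    [/\ 0 <= r, r < `|x| & forall y : R, r < `|y| -> lconverges f y].

(* A rational number p/q is counted once and q is the denominator of its
   reduced form. The supremum is taken in the extended reals. *)
Definition irrationality_exponent (xi : R) : \bar R :=
  ereal_sup [set mu%:E | mu in [set mu : R |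
    infinite_set [set r : rat |
      `|xi - ratr r| < ((denq r)%:~R : R) `^ (- mu)]]].

End Evaluation.

(* Main.v *)
From Pilot Require Import Defs.
From mathcomp Require Import all_boot all_order all_algebra all_field.
From mathcomp Require Import all_classical all_reals all_analysis.
From mathcomp Require Import zify ring lra.

Set Implicit Arguments.
Unset Strict Implicit.
Unset Printing Implicit Defensive.

Import Order.TTheory GRing.Theory Num.Theory.
Import numFieldNormedType.Exports.
Local Open Scope classical_set_scope.
Local Open Scope ring_scope.

(* By Laurent series division, f has convergents P/Q, where P f - Q has order
   z^-e, e is the degree of the next denominator, and deg P < e.  Let lambda be
   the limsup of e / deg P.  Since f(b) equals f(b^(d^m)) up to a product of m
   rational factors whose height is |b|^O(d^m), evaluating the convergents at
   b^(d^m) gives a set of rational approximations of f(b) that is dense enough,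
   on a logarithmic scale, to yield mu(f(b)) = 1 + lambda.

   Lambda is rational because the functional equation sends the gap
   (deg P, e) to the gap (d deg P + deg B - g, d e - deg A + g), where g is the
   degree of gcd(P(z^d) B, Q(z^d) A), and conversely every long gap is such an
   image: take a section modulo d of P A.  Hence the long gaps lie in chains,
   of which only finitely many matter for lambda.  Along a chain g is
   eventually periodic, as one sees on the orbits of the roots of A B under
   w |-> w^d, so that e / deg P tends to a rational number.

   If |b| = 1 then the coefficients of f decay geometrically; taking sections
   repeatedly makes the coefficients of some P f decay faster than their
   denominators can grow, so that f is a rational function and f(b) is
   rational. *)

(** * Eventually periodic multiplicities *)

(** Growth is recorded with additive errors: a rate [r] comes with a constant [K] such that e <= r
    deg P + K for every gap and e >= r deg P - K for gaps of arbitrarily large degree. This is why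
    the evaluated convergents may be fractions far from reduced. The upper bound for mu compares p/q
    with two of them whose determinant is nonzero, so that at least one differs from p/q. The
    obstacle to the periodicity of g is that the multiplicities of P and Q at a root may grow
    without bound. But g is a sum, over the roots w of A B, of minima of two multiplicities. Since P
    and Q are coprime, one signed integer, the multiplicity in P minus that in Q, encodes both. It
    obeys an affine recursion with nonnegative slopes along the orbit of w, hence is eventually
    monotone on residue classes, and the minimum is a bounded monotone function of it. Once g is
    periodic, deg P and e are rational multiples of d^m up to bounded errors. *)

Lemma uniform_bound (n : nat) (P : nat -> nat -> Prop) :
  (forall j K K', (K <= K')%N -> P j K -> P j K') ->
  (forall j, (j < n)%N -> exists K, P j K) ->
  exists K, forall j, (j < n)%N -> P j K.
Proof.
move=> mono; elim: n => [|n IH] h; first by exists 0%N.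
have [K hK] := IH (fun j hj => h j (ltnW hj)).
have [K' hK'] := h n (ltnSn n).
exists (maxn K K') => j; rewrite ltnS leq_eqVlt => /orP[/eqP ->|/hK].
  exact: mono (leq_maxr _ _) hK'.
exact: mono (leq_maxl _ _).
Qed.

Definition evper T (x : nat -> T) :=
  exists s l, (0 < l)%N /\ forall i, (s <= i)%N -> x (i + l)%N = x i.

Lemma evper_mul T (x : nat -> T) s l k i :
  (forall i, (s <= i)%N -> x (i + l)%N = x i) -> (s <= i)%N ->
  x (i + k * l)%N = x i.
Proof.
move=> h si; elim: k => [|k IH]; first by rewrite addn0.
by rewrite mulSn [(l + _)%N]addnC addnA h ?IH //; lia.
Qed.

Lemma evper_add (x y : nat -> nat) :
  evper x -> evper y -> evper (fun i => x i + y i)%N.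
Proof.
move=> [s [l [l0 hx]]] [s' [l' [l0' hy]]].
exists (s + s')%N, (l * l')%N; split=> [|i hi]; first by rewrite muln_gt0 l0.
by rewrite {1}[(l * l')%N]mulnC (evper_mul _ hx) ?(evper_mul _ hy) //; lia.
Qed.

Lemma evper_sum (I : eqType) (r : seq I) (x : I -> nat -> nat) :
  (forall w, w \in r -> evper (x w)) -> evper (fun i => \sum_(w <- r) x w i)%N.
Proof.
elim: r => [|w r IH] h.
  by exists 0%N, 1%N; split=> // i _; rewrite !big_nil.
have [s [l [l0 hs]]] : evper (fun i => x w i + \sum_(w <- r) x w i)%N.
  apply: evper_add; first by apply: h; rewrite mem_head.
  by apply: IH => v hv; apply: h; rewrite inE hv orbT.
by exists s, l; split=> // i hi; rewrite !big_cons hs.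
Qed.

Lemma nondecreasing_bounded_stable (u : nat -> nat) M :
  (forall k, u k <= u k.+1)%N -> (forall k, u k <= M)%N ->
  exists k0, forall k, (k0 <= k)%N -> u k = u k0.
Proof.
move=> mono bd.
have mono2 j k : (j <= k)%N -> (u j <= u k)%N.
  by move/subnK => <-; elim: (k - j)%N => // n IH; apply: leq_trans IH (mono _).
have hex : exists n, `[< exists k, u k = n >] by exists (u 0); apply/asboolP; exists 0.
have hbd n : `[< exists k, u k = n >] -> (n <= M)%N by move=> /asboolP[k <-].
case: (ex_maxnP hex hbd) => _ /asboolP[k0 <-] hmax; exists k0 => k hk.
apply/eqP; rewrite eqn_leq (mono2 _ _ hk) andbT hmax //; apply/asboolP; by exists k.
Qed.

Lemma nonincreasing_stable (u : nat -> nat) : (forall k, u k.+1 <= u k)%N ->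
  exists k0, forall k, (k0 <= k)%N -> u k = u k0.
Proof.
move=> mono.
have u0 k : (u k <= u 0)%N by elim: k => // k; apply: leq_trans.
have [k|k|k0 h] := @nondecreasing_bounded_stable (fun k => u 0 - u k)%N (u 0).
- by rewrite leq_sub2l.
- by rewrite leq_subr.
- by exists k0 => k /h; have := u0 k; have := u0 k0; lia.
Qed.

(* Along each residue class modulo [l] the sequence is eventually monotone;
   the direction may depend on the class. *)
Definition classwise_monotone (x : nat -> int) :=
  exists s l, (0 < l)%N /\ forall j, (s <= j)%N ->
   (forall k, x (j + k * l)%N <= x (j + k.+1 * l)%N) \/
   (forall k, x (j + k.+1 * l)%N <= x (j + k * l)%N).

(** [x] may be unbounded, but [phi] is bounded and monotone, so on each residue class the values are
    a bounded monotone sequence of naturals and become constant. There are [l] classes, so one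
    threshold serves all. *)
Lemma classwise_monotone_evper (x : nat -> int) (phi : int -> nat) M :
  classwise_monotone x -> (forall y, phi y <= M)%N ->
  (forall y z : int, y <= z -> (phi y <= phi z)%N) \/
  (forall y z : int, y <= z -> (phi z <= phi y)%N) ->
  evper (fun i => phi (x i)).
Proof.
move=> [s [l [l0 hx]]] bd hphi.
have st j : exists K, forall k, (K <= k)%N ->
    phi (x (s + j + k.+1 * l)%N) = phi (x (s + j + k * l)%N).
  suff [K hK] : exists k0, forall k, (k0 <= k)%N ->
      phi (x (s + j + k * l)%N) = phi (x (s + j + k0 * l)%N).
    by exists K => k hk; rewrite !(hK _) // ltnW.
  have hsj : (s <= s + j)%N by rewrite leq_addr.
  case: (hx _ hsj) hphi => hm [] hp.
  - by apply: (@nondecreasing_bounded_stable _ M) => k //; apply: hp.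
  - by apply: nonincreasing_stable => k; apply: hp.
  - by apply: nonincreasing_stable => k; apply: hp.
  - by apply: (@nondecreasing_bounded_stable _ M) => k //; apply: hp.
have [K hK] := @uniform_bound l (fun j K => forall k, (K <= k)%N ->
    phi (x (s + j + k.+1 * l)%N) = phi (x (s + j + k * l)%N))
    (fun j K K' h hk k hk' => hk k (leq_trans h hk')) (fun j _ => st j).
exists (s + K * l)%N, l; split=> // i hi.
have hr : ((i - s) %% l < l)%N by rewrite ltn_mod.
have hq : (K <= (i - s) %/ l)%N by rewrite leq_divRL //; lia.
have := hK _ hr _ hq.
have -> : (s + (i - s) %% l + (i - s) %/ l * l)%N = i.
  by have := divn_eq (i - s) l; lia.
have -> : (s + (i - s) %% l + ((i - s) %/ l).+1 * l)%N = (i + l)%N.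
  by have := divn_eq (i - s) l; rewrite mulSn; lia.
by [].
Qed.

Lemma classwise_monotone_affine (x : nat -> int) (t e : int) : 0 <= e ->
  classwise_monotone x -> classwise_monotone (fun i => t + e * x i).
Proof.
move=> e0 [s [l [l0 h]]]; exists s, l; split=> // j /h [hj|hj]; [left|right] => k;
  by rewrite lerD2l ler_wpM2l.
Qed.

Lemma classwise_monotone_shift (x : nat -> int) :
  classwise_monotone (fun i => x i.+1) -> classwise_monotone x.
Proof.
move=> [s [l [l0 h]]]; exists s.+1, l; split=> // [[//|j]] hj; exact: h.
Qed.

Lemma classwise_monotone_const (t : int) : classwise_monotone (fun=> t).
Proof. by exists 0%N, 1%N; split=> // j _; left. Qed.

Lemma eq_classwise_monotone (x y : nat -> int) : x =1 y ->
  classwise_monotone x -> classwise_monotone y.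
Proof. by move=> /funext ->. Qed.

(** * Affine recursions along the orbits of a map *)

Section Orbit.
Variables (F : eqType) (step : F -> F) (E : F -> int) (e : F -> int).
Variables (D : nat -> F -> int) (W : seq F).
Hypothesis e0 : forall v, 0 <= e v.
Hypothesis DS : forall i v, D i.+1 v = E v + e v * D i (step v).
Hypothesis EW : forall v, v \notin W -> E v = 0.
Hypothesis DW : forall v, v \notin W -> D 0 v = 0.

Lemma orbit_leaves_seq (o : nat -> F) : injective o ->
  exists t0, forall t, (t0 <= t)%N -> o t \notin W.
Proof.
move=> inj; elim: W => [|w V [t0 IH]]; first by exists 0%N.
have [[t1 <-]|h] := pselect (exists t, o t = w).
  exists (maxn t0 t1.+1) => t; rewrite geq_max => /andP[h0 h1].
  rewrite inE negb_or IH // andbT; apply/eqP => /inj; lia.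
exists t0 => t ht; rewrite inE negb_or IH // andbT.
by apply/eqP => ew; apply: h; exists t.
Qed.

(** By [DS] the property passes from a later point of the orbit to an earlier one, so only the
    eventual behaviour of the orbit matters. An infinite orbit finally avoids [W], where [D]
    vanishes; any other orbit runs into a cycle. *)
Lemma classwise_monotone_orbit v : classwise_monotone (D ^~ v).
Proof.
pose o t := iter t step v.
have back t u : classwise_monotone (D ^~ (iter t step u)) -> classwise_monotone (D ^~ u).
  elim: t u => // t IH u; rewrite iterSr => /IH h.
  apply: classwise_monotone_shift.
  apply: eq_classwise_monotone (classwise_monotone_affine (E u) (e0 u) h).
  by move=> i; rewrite DS.
have [inj|ninj] := pselect (injective o).
  have [t0 ht0] := orbit_leaves_seq inj.
  apply: (back t0); apply: eq_classwise_monotone (classwise_monotone_const 0) => i.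
  suff : forall t, (t0 <= t)%N -> D i (o t) = 0 by move=> /(_ t0 (leqnn _)).
  elim: i => [|i IH] t ht; first by rewrite DW // ht0.
  by rewrite DS EW ?ht0 // -iterS (IH t.+1) ?mulr0 // ltnW.
have [t [n hn]] : exists t n, iter n.+1 step (o t) = o t.
  apply: contrapT => h; apply: ninj => t t' ett.
  wlog lt : t t' ett / (t < t')%N.
    move=> H; case: (ltngtP t t') => // hl; first exact: H.
    by apply/esym/H.
  exfalso; apply: h; exists t, (t' - t).-1.
  by rewrite prednK ?subn_gt0 // /o -iterD subnK ?ett // ltnW.
apply: (back t); rewrite -/(o t); move: (o t) hn => u hu.
(* Going once around the cycle composes the affine maps into a single one of slope [p >= 0].
   Successive differences on a residue class are multiplied by [p], so their sign persists. *)
have [s [p [p0 hp]]] : exists s p : int, 0 <= p /\ forall i,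
    D (i + n.+1)%N u = s + p * D i (iter n.+1 step u).
  elim: n.+1 {hu} u => [|k IH] u; first by exists 0, 1; split=> // i; rewrite addn0; ring.
  have [s [p [p0 h]]] := IH (step u).
  exists (E u + e u * s), (e u * p); split=> [|i]; first by rewrite mulr_ge0.
  by rewrite addnS DS h iterSr; ring.
rewrite hu in hp; exists 0%N, n.+1; split=> // j _.
have diff k : D (j + k.+1 * n.+1)%N u - D (j + k * n.+1)%N u =
    p ^+ k * (D (j + n.+1)%N u - D j u).
  elim: k => [|k IH]; first by rewrite mul1n mul0n addn0 mul1r.
  rewrite exprS -mulrA -IH ![(_.+1 * n.+1)%N]mulSn.
  rewrite ![(n.+1 + _)%N]addnC !addnA !hp; ring.
have [h|h] := lerP (D j u) (D (j + n.+1)%N u); [left|right] => k.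
  by rewrite -subr_ge0 diff mulr_ge0 ?exprn_ge0 // subr_ge0.
by rewrite -subr_le0 diff mulr_ge0_le0 ?exprn_ge0 // subr_le0 ltW.
Qed.
End Orbit.

(** * Multiplicities of roots and the degree of a gcd *)

Section Multiplicity.
Variable F : closedFieldType.
Implicit Types (p q : {poly F}) (v w : F).

Lemma mup_exp w p k : p != 0 -> mup w (p ^+ k) = (k * mup w p)%N.
Proof.
move=> p0; elim: k => [|k IH].
  by rewrite mupNroot // rootE hornerE oner_eq0.
by rewrite exprS mupM ?expf_neq0 // IH mulSn.
Qed.

(* Ramification index of z |-> z^d at w; its value is never needed. *)
Definition ramif d w := mup w ('X^d - (w ^+ d)%:P).

(** Only the power of ['X - (w ^+ d)%:P] in [p] counts: the cofactor does not vanish at [w ^+ d], so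
    after the substitution it does not vanish at [w]. *)
Lemma mup_comp_Xn d w p : (0 < d)%N -> p != 0 ->
  mup w (p \Po 'X^d) = (ramif d w * mup (w ^+ d) p)%N.
Proof.
move=> d0 p0; have [k [q]] := multiplicity_XsubC p (w ^+ d).
rewrite p0 /= => hq ep.
have q0 : q != 0 by apply: contraNneq p0 => e; rewrite ep e mul0r.
have X0 : 'X^d - (w ^+ d)%:P != 0 by rewrite -size_poly_gt0 size_XnsubC.
have mp : mup (w ^+ d) p = k.
  by rewrite ep mupMr // mup_XsubCX eqxx.
rewrite mp {1}ep comp_polyM rmorphXn /= comp_polyB comp_polyX comp_polyC.
rewrite mupMr ?mup_exp // 1?mulnC //.
by rewrite root_comp hornerXn.
Qed.

Lemma mup_gcdp w p q : p != 0 -> q != 0 ->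
  mup w (gcdp p q) = minn (mup w p) (mup w q).
Proof.
move=> p0 q0; have g0 : gcdp p q != 0 by rewrite gcdp_eq0 negb_and p0.
have key n : (n <= mup w (gcdp p q))%N = (n <= minn (mup w p) (mup w q))%N.
  by rewrite leq_min !mup_geq // dvdp_gcd.
by apply/eqP; rewrite eqn_leq -key leqnn key leqnn.
Qed.

Lemma size_sum_mup p (W : seq F) : p != 0 -> uniq W ->
  (forall w, root p w -> w \in W) -> (size p).-1 = (\sum_(w <- W) mup w p)%N.
Proof.
move=> p0 uW hW; have [r er] := closed_field_poly_normal p.
have lc0 : lead_coef p != 0 by rewrite lead_coef_eq0.
have mw w : mup w p = count_mem w r.
  rewrite {1}er -mul_polyC mupMr ?mu_prod_XsubC // rootC //.
have rW : {subset r <= W}.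
  move=> w hw; apply: hW; rewrite er rootZ // root_prod_XsubC //.
rewrite {1}er size_scale // size_prod_XsubC /= (eq_bigr _ (fun w _ => mw w)).
elim: r rW {er mw} => [|z r IH] rW; first by rewrite big1.
rewrite /= big_split /= -IH => [|w hw]; last by apply: rW; rewrite inE hw orbT.
rewrite -add1n; congr (_ + _)%N.
have zW : z \in W by apply: rW; rewrite mem_head.
by rewrite (bigD1_seq z) //= eqxx big1 // => w; rewrite eq_sym => /negbTE ->.
Qed.

Variables (d : nat) (a b : {poly F}) (p q h : nat -> {poly F}).
Hypotheses (d0 : (0 < d)%N) (a0 : a != 0) (b0 : b != 0).
Hypotheses (p0 : forall i, p i != 0) (q0 : forall i, q i != 0).
Hypothesis cop : forall i, coprimep (p i) (q i).
Hypothesis hE : forall i, h i = gcdp ((p i \Po 'X^d) * b) ((q i \Po 'X^d) * a).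
Hypothesis pS : forall i, h i * p i.+1 = (p i \Po 'X^d) * b.
Hypothesis qS : forall i, h i * q i.+1 = (q i \Po 'X^d) * a.

(** The degree of [h i] is the sum of its multiplicities at the roots of [a * b], and at such a root
    [w] the multiplicity is a function of the single integer [D i (w ^+ d)]. *)
Lemma evper_size_gcdp : evper (fun i => (size (h i)).-1).
Proof.
have comp0 (r : {poly F}) : r != 0 -> r \Po 'X^d != 0.
  by move=> r0; rewrite comp_poly_eq0 // size_polyXn.
have h0 i : h i != 0.
  by rewrite hE gcdp_eq0 negb_and mulf_neq0 // comp0.
have roots (r : {poly F}) : r != 0 -> exists W : seq F, forall w, root r w -> w \in W.
  move=> r0; have [W er] := closed_field_poly_normal r; exists W => w.
  by rewrite er rootZ ?lead_coef_eq0 // root_prod_XsubC.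
have [W0 hW0] := roots (a * b) (mulf_neq0 a0 b0).
have [W1 hW1] := roots (p 0 * q 0) (mulf_neq0 (p0 0) (q0 0)).
(* The common factor [h i] cancels in this difference, so the recursion under [v |-> v ^+ d] does
   not involve the gcd: its slope is [ramif d v] and its constant term comes from [a] and [b]
   alone. *)
pose D i v : int := (mup v (p i))%:Z - (mup v (q i))%:Z.
have mupW (r s : {poly F}) (V : seq F) v : (forall w, root (r * s) w -> w \in V) ->
    v \notin V -> mup v r = 0%N /\ mup v s = 0%N.
  move=> hV vV; have := contra (hV v) vV; rewrite rootM negb_or => /andP[h1 h2].
  by rewrite !mupNroot.
have EMD v : classwise_monotone (D ^~ v).
  apply: (@classwise_monotone_orbit F (fun v => v ^+ d)
    (fun v => (mup v b)%:Z - (mup v a)%:Z) (fun v => (ramif d v)%:Z) D (W0 ++ W1)) => //.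
  - move=> i w; have := congr1 (mup w) (pS i); have := congr1 (mup w) (qS i).
    rewrite !mupM ?comp0 // !mup_comp_Xn // /D => e1 e2.
    by rewrite mulrBr -!PoszM; lia.
  - move=> w; rewrite mem_cat negb_or => /andP[w0 _].
    by have [-> ->] := mupW _ _ _ _ hW0 w0.
  - move=> w; rewrite mem_cat negb_or => /andP[_ w1].
    by rewrite /D; have [-> ->] := mupW _ _ _ _ hW1 w1.
have cop0 i v : mup v (p i) = 0%N \/ mup v (q i) = 0%N.
  have [/(coprimep_root (cop i))|/mupNroot] := boolP (root (p i) v); last by left.
  by rewrite -rootE => /mupNroot; right.
(* After the substitution [p i] and [q i] still have no common root, so every root of [h i] is a
   root of [a * b]. *)
have sizeE i : (size (h i)).-1 = (\sum_(w <- undup W0) mup w (h i))%N.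
  apply: size_sum_mup; rewrite ?undup_uniq // => w hw; rewrite mem_undup hW0 //.
  move: hw; rewrite hE root_gcd !rootM => /andP[].
  rewrite !root_comp hornerXn.
  case/orP => [rp|->]; last by rewrite orbT.
  case/orP => [rq|->]; last by [].
  by have := coprimep_root (cop i) rp; move: rq; rewrite rootE => ->.
have -> : (fun i => (size (h i)).-1) = fun i => (\sum_(w <- undup W0) mup w (h i))%N.
  by apply/funext.
apply: evper_sum => w _.
(* By coprimality one of the two multiplicities at a point is zero, so they are the positive and the
   negative part of [D i]. *)
pose pos (y : int) := if y is Posz n then n else 0%N.
pose neg (y : int) := if y is Negz n then n.+1 else 0%N.
pose phi y := minn (ramif d w * pos y + mup w b) (ramif d w * neg y + mup w a).
have -> : (fun i => mup w (h i)) = fun i => phi (D i (w ^+ d)).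
  apply/funext => i; rewrite hE mup_gcdp ?mulf_neq0 ?comp0 //.
  rewrite !mupM ?comp0 // !mup_comp_Xn // /phi /D.
  case: (cop0 i (w ^+ d)) => ->.
    by rewrite sub0r; case: (mup _ (q i)) => [|n] //=; rewrite -NegzE.
  by rewrite subr0.
apply: (classwise_monotone_evper (M := (mup w a + mup w b)%N)) => //.
  by move=> [n|n]; rewrite /phi /= muln0 add0n geq_min ?leq_addr ?leq_addl ?orbT.
(* If [b] has at most the multiplicity of [a], then [phi] is constant on negative arguments and
   nondecreasing on the others; otherwise it is constant on the nonnegative ones and nonincreasing
   on the negative ones. *)
rewrite /phi; case: (leqP (mup w b) (mup w a)) => hab; [left|right];
  by move=> [n|n] [m|m] nm /=; rewrite ?muln0; nia.
Qed.
End Multiplicity.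

(** * Growth of gaps under the functional equation *)

Lemma expn_unbounded (d : nat) (x : rat) : (1 < d)%N -> exists m, x < (d ^ m)%:R.
Proof.
move=> d1; have h := archi_boundP (normr_ge0 x); exists (Num.bound `|x|).
apply: le_lt_trans (ler_norm x) (lt_le_trans h _).
by rewrite ler_nat ltnW // ltn_expl.
Qed.

Lemma evper_bounded (w : nat -> rat) : evper w -> exists K, forall m, `|w m| <= K.
Proof.
move=> [s [l [l0 h]]]; exists (\sum_(i < s + l) `|w i|) => m.
elim/ltn_ind: m => m IH; have [ml|ml] := ltnP m (s + l)%N.
  by rewrite (bigD1 (Ordinal ml)) //= lerDl sumr_ge0.
have -> : w m = w (m - l)%N by rewrite -[in LHS](@subnK l m) ?h //; lia.
by apply: IH; lia.
Qed.

(* The difference x (m + l) - x m is eventually geometric, since h cancels. *)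
Lemma linear_rec_growth (d : nat) (x h : nat -> rat) : (1 < d)%N ->
  (forall m, x m.+1 = d%:R * x m + h m) -> evper h ->
  exists k K, forall m, `|x m - k * (d ^ m)%:R| <= K.
Proof.
move=> d1 xS [s [l [l0 hl]]].
pose z m := x (m + l)%N - x m.
have zS m : (s <= m)%N -> z m.+1 = d%:R * z m.
  by move=> sm; rewrite /z addSn !xS hl //; ring.
have zE m : z (s + m)%N = (d ^ m)%:R * z s.
  elim: m => [|m IH]; first by rewrite addn0 mul1r.
  by rewrite addnS zS ?leq_addr // IH expnS natrM mulrA.
have dn0 m : (d ^ m)%:R != 0 :> rat by rewrite pnatr_eq0 expn_eq0; lia.
have dl : (d ^ l)%:R - 1 != 0 :> rat.
  by rewrite subr_eq0 pnatr_eq1 eqn_leq negb_and -!ltnNge; apply/orP; left;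
    rewrite -(expn0 d) ltn_exp2l.
(* This constant gives [k * (d ^ m)%:R] the same increments over [l] steps as [x] has from [s] on,
   so their difference is eventually periodic, hence bounded. *)
exists (z s / ((d ^ s)%:R * ((d ^ l)%:R - 1))).
set k := _ / _; apply: (@evper_bounded (fun m => x m - k * (d ^ m)%:R)).
exists s, l; split=> // m sm.
apply/eqP; rewrite -subr_eq0; apply/eqP.
have -> : x (m + l)%N - k * (d ^ (m + l))%:R - (x m - k * (d ^ m)%:R) =
  z m - k * (d ^ m)%:R * ((d ^ l)%:R - 1) by rewrite /z expnD natrM; ring.
rewrite -(subnKC sm) zE expnD natrM /k; field.
by rewrite dl dn0.
Qed.

(** Here [a] and [b] stand for the degrees of [A] and [B], and [g] for the degree of the cancelled
    gcd. The additive form avoids truncated subtraction. *)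
Definition up_step (d a b x e x' e' g : nat) :=
  [/\ (x' + g = d * x + b)%N, (e' + a = d * e + g)%N & (g <= a + b)%N].

Section GapGrowth.
Variables (d a b : nat) (gap : nat -> nat -> Prop).
Hypothesis d1 : (1 < d)%N.
Hypothesis gap_lt : forall x e, gap x e -> (x < e)%N.
Hypothesis gap_uniq : forall x e x' e', gap x e -> gap x' e' ->
  (x < e')%N -> (x' < e)%N -> x = x' /\ e = e'.
Hypothesis gap_ex : forall n, exists x e, [/\ gap x e, (x <= n)%N & (n < e)%N].
Hypothesis gap_down : forall x e, gap x e -> (2 * (a + b) < e - x)%N ->
  exists x1 e1 g, [/\ gap x1 e1, up_step d a b x1 e1 x e g &
    (a + b < d * (e1 - x1))%N].
Hypothesis gap_chain : forall x e, gap x e -> (2 * (a + b).+1 < e - x)%N ->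
  exists X E g : nat -> nat, [/\ X 0%N = x, E 0%N = e, forall m, gap (X m) (E m),
    forall m, up_step d a b (X m) (E m) (X m.+1) (E m.+1) (g m) & evper g].

Local Notation C := (a + b).+1.

(** Under [up_step] the length minus [C] grows at least by the factor [d]; a gap longer than [2 * C]
    thus has ever longer images. *)
Definition big_gap x e := gap x e /\ (2 * C < e - x)%N.

Fixpoint reach m x e y f :=
  if m is m'.+1 then exists y1 f1 g,
    [/\ reach m' x e y1 f1, big_gap y1 f1, gap y f & up_step d a b y1 f1 y f g]
  else x = y /\ e = f.

Lemma reach_bounds m x e y f : (x < e)%N -> reach m x e y f ->
  (d ^ m * x <= y + d ^ m * a)%N /\ (f - y <= d ^ m * (e - x + C))%N.
Proof.
(* The added [a] and [C] absorb the error of each step, so that both inequalities survive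
   multiplication by [d] and the induction closes. *)
move=> xe; suff : reach m x e y f ->
  (d ^ m * x + a <= y + d ^ m * a)%N /\ (f - y + C <= d ^ m * (e - x + C))%N.
  by move=> h /h; lia.
elim: m y f => [|m IH] y f /=; first by move=> [-> ->]; lia.
move=> [y1 [f1 [g [/IH[h1 h2] [/gap_lt lt1 _] /gap_lt lt2 [u1 u2 u3]]]]].
rewrite expnS; have : (f - y + a + b = d * (f1 - y1) + 2 * g)%N by nia.
by split; nia.
Qed.

(** Two images of one big gap both cover the degrees between [d * x + b] and [d * e - a], whatever
    their [g]; so they overlap and [gap_uniq] identifies them. *)
Lemma reach_chain m x e y f (X E g : nat -> nat) : X 0%N = x -> E 0%N = e ->
  (forall m, gap (X m) (E m)) ->
  (forall m, up_step d a b (X m) (E m) (X m.+1) (E m.+1) (g m)) ->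
  reach m x e y f -> y = X m /\ f = E m.
Proof.
move=> X0 E0 hg hu; elim: m y f => [|m IH] y f /=; first by move=> [<- <-].
move=> [y1 [f1 [g1 [/IH[-> ->] [/gap_lt lt1 hb] hgap [u1 u2 u3]]]]].
have [v1 v2 v3] := hu m.
by apply: gap_uniq => //; nia.
Qed.

(** The lower half of a limsup, sharpened: the defect is a constant. *)
Definition attained (r : rat) := exists K, forall Y : nat, exists x e,
  [/\ gap x e, (Y <= x)%N & r * x%:R - K <= e%:R].

(** By [linear_rec_growth] both ends of the gaps in the chain are rational multiples of [d ^ m] up
    to bounded errors, and [r] is the quotient of the two multiples. *)
Lemma big_gap_rate x e : big_gap x e -> exists r K : rat,
  [/\ 1 < r, attained r & forall m y f, reach m x e y f -> f%:R <= r * y%:R + K].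
Proof.
move=> [hgap hbig]; have [X [E [g [X0 E0 hg hu hper]]]] := gap_chain hgap hbig.
have lenge m : (d ^ m * C + C <= E m - X m)%N.
  elim: m => [|m IH]; first by rewrite X0 E0; lia.
  have [u1 u2 u3] := hu m; rewrite expnS.
  have l1 := gap_lt (hg m); have l2 := gap_lt (hg m.+1).
  have : (E m.+1 - X m.+1 + a + b = d * (E m - X m) + 2 * g m)%N by nia.
  by nia.
have natE (u v : nat) : u = v -> u%:R = v%:R :> rat by move=> ->.
have [kx [Kx hx]] : exists k K, forall m, `|(X m)%:R - k * (d ^ m)%:R| <= K :> rat.
  apply: (@linear_rec_growth d _ (fun m => b%:R - (g m)%:R)) => // [m|].
    have [u1 _ _] := hu m; have := natE _ _ u1.
    by rewrite !natrD natrM => h; apply: (addIr (g m)%:R); rewrite h; ring.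
  by have [s [l [l0 h]]] := hper; exists s, l; split=> // i /h ->.
have [ke [Ke he]] : exists k K, forall m, `|(E m)%:R - k * (d ^ m)%:R| <= K :> rat.
  apply: (@linear_rec_growth d _ (fun m => (g m)%:R - a%:R)) => // [m|].
    have [_ u2 _] := hu m; have := natE _ _ u2.
    by rewrite !natrD natrM => h; apply: (addIr a%:R); rewrite h; ring.
  by have [s [l [l0 h]]] := hper; exists s, l; split=> // i /h ->.
(* If all [X m] were at most [n], the gap around [n] would overlap all late gaps of the chain and
   coincide with them, although their lengths tend to infinity. *)
have kx0 : 0 < kx.
  rewrite ltNge; apply/negP => kx0.
  have [n hn] : exists n : nat, forall m, (X m <= n)%N.
    exists (Num.bound `|Kx|) => m; rewrite ltnW // -(ltr_nat rat).
    apply: le_lt_trans (archi_boundP (normr_ge0 _)).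
    apply: le_trans (ler_norm _); have := hx m; rewrite ler_norml => /andP[_].
    have : kx * (d ^ m)%:R <= 0 by rewrite mulr_le0_ge0.
    by lra.
  have [xs [es [hs1 hs2 hs3]]] := gap_ex n.
  have same m : (es <= m)%N -> X m = xs /\ E m = es.
    move=> hm; have lm := lenge m; have lt := ltn_expl m d1.
    by apply: gap_uniq => //; have := hn m; nia.
  have [e1 e2] := same es (leqnn _); have [e3 e4] := same es.+1 (leqnSn _).
  by have := lenge es; have := ltn_expl es d1; nia.
have kxe : kx < ke.
  rewrite ltNge; apply/negP => kxe.
  have [m hm] := expn_unbounded (Kx + Ke) d1.
  have lm := lenge m; have : (d ^ m + X m <= E m)%N by nia.
  rewrite -(ler_nat rat) natrD => h.
  have := hx m; have := he m; rewrite !ler_norml => /andP[_ h1] /andP[h2 _].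
  have : ke * (d ^ m)%:R <= kx * (d ^ m)%:R by rewrite ler_wpM2r.
  by lra.
set r := ke / kx.
have r1 : 1 < r by rewrite ltr_pdivlMr // mul1r.
have rkx : r * kx = ke by rewrite divfK // gt_eqF.
have r0 : 0 < r by lra.
have key m : `|(E m)%:R - r * (X m)%:R| <= Ke + r * Kx.
  have -> : (E m)%:R - r * (X m)%:R = ((E m)%:R - ke * (d ^ m)%:R) -
     r * ((X m)%:R - kx * (d ^ m)%:R) by rewrite -rkx; ring.
  apply: le_trans (ler_normB _ _) _; rewrite lerD // normrM gtr0_norm //.
  by rewrite ler_wpM2l // ltW.
exists r, (Ke + r * Kx); split=> //.
  exists (Ke + r * Kx) => Y.
  have [m hm] := expn_unbounded ((Y%:R + Kx) / kx) d1.
  exists (X m), (E m); split=> //; last first.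
    by have := key m; rewrite ler_norml => /andP[h _]; lra.
  rewrite -(ler_nat rat); move: hm; rewrite ltr_pdivrMr // => hm.
  by have := hx m; rewrite ler_norml => /andP[h _]; lra.
move=> m y f /(reach_chain X0 E0 hg hu) [-> ->].
by have := key m; rewrite ler_norml => /andP[_ h]; lra.
Qed.

(** The bound is chosen so that any longer gap comes, through [gap_down], from one that is still
    big: a step multiplies the length by [d] and adds at most [a + b]. *)
Definition root_gap x e := big_gap x e /\ (e - x <= (2 * d).+1 * C)%N.

Lemma big_gap_root y f : big_gap y f -> exists x e m, root_gap x e /\ reach m x e y f.
Proof.
have [n] := ubnP (f - y); elim: n y f => // n IH y f hn hb.
have [hs|hl] := leqP (f - y) ((2 * d).+1 * C).
  by exists y, f, 0%N.
have [hgap hbig] := hb.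
have [||x1 [e1 [g [hg1 hu _]]]] := @gap_down y f; rewrite //; first by lia.
have lt1 := gap_lt hg1; have lt := gap_lt hgap; have [u1 u2 u3] := hu.
have eq : (f - y + a + b = d * (e1 - x1) + 2 * g)%N by nia.
have hb1 : big_gap x1 e1 by split=> //; nia.
have [|x [e [m [h1 h2]]]] := IH x1 e1 _ hb1; first by nia.
by exists x, e, m.+1; split=> //; exists x1, e1, g.
Qed.

Lemma attained1 (K : nat) : (forall x e, gap x e -> (e <= x + K)%N) -> attained 1.
Proof.
move=> h; exists 0 => Y; have [x [e [h1 h2 h3]]] := gap_ex (Y + K).
exists x, e; split=> //; first by have := h _ _ h1; lia.
by rewrite mul1r subr0 ler_nat; have := gap_lt h1; lia.
Qed.

(** A maximum of rates has to exist among possibly infinitely many chains. Root gaps have bounded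
    length, so those of large degree produce rates at most [r1]; what remains are the roots with
    [x < X], at most one for each [x]. *)
Lemma gap_ratio : exists r K : rat, [/\ 1 <= r, attained r &
  forall x e, gap x e -> e%:R <= r * x%:R + K].
Proof.
have [[y0 [f0 hb0]]|hnb] := pselect (exists x e, big_gap x e); last first.
  have h x e : gap x e -> (e <= x + 2 * C)%N.
    move=> hg; rewrite leqNgt; apply/negP => hl; apply: hnb; exists x, e.
    by split=> //; lia.
  exists 1, (2 * C)%:R; split=> //; first exact: attained1 h.
  by move=> x e /h; rewrite mul1r -natrD ler_nat.
have [r1 [K1 [r11 att1 hr1]]] := big_gap_rate hb0.
have C0 : 0 < C%:R :> rat by rewrite ltr0n.
pose L := ((2 * d).+1 * C)%N.
(* Multiplied by [d ^ m], the left side bounds the length reached from a root gap, and for [X <= x]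
   the right side is at most [(r1 - 1) * y], both by [reach_bounds]. *)
have [X hX] : exists X : nat, (L + C)%:R <= (r1 - 1) * (X%:R - a%:R) :> rat.
  have := archi_boundP (normr_ge0 ((L + C)%:R / (r1 - 1) + a%:R)).
  set X := Num.bound _ => hX; exists X.
  rewrite mulrC -ler_pdivrMr ?subr_gt0 //.
  by rewrite lerBrDr; apply: le_trans (ler_norm _) (ltW hX).
have [r [K [hr att hK]]] : exists r K : rat, [/\ r1 <= r, attained r &
    forall x e, root_gap x e -> (x < X)%N ->
    forall m y f, reach m x e y f -> f%:R <= r * y%:R + K].
  elim: {hX} X => [|X [r [K [hr att hK]]]]; first by exists r1, K1.
  have [[e he]|hn] := pselect (exists e, root_gap X e); last first.
    exists r, K; split=> // x e hx; rewrite ltnS leq_eqVlt => /orP[/eqP eX|].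
      by case: hn; exists e; rewrite -eX.
    by move=> xX; apply: hK.
  have [r2 [K2 [r21 att2 hr2]]] := big_gap_rate (proj1 he).
  exists (Num.max r r2), (Num.max K K2); split.
  - by rewrite le_max hr.
  - by case: (leP r r2).
  move=> x e' hx xX m y f hm.
  have ub r' K' : r' <= Num.max r r2 -> K' <= Num.max K K2 ->
      f%:R <= r' * y%:R + K' -> f%:R <= Num.max r r2 * y%:R + Num.max K K2.
    by move=> h1 h2 h; apply: le_trans h _; rewrite lerD // ler_wpM2r.
  move: xX; rewrite ltnS leq_eqVlt => /orP[/eqP eX|xX].
    apply: (ub r2 K2); rewrite ?le_max ?lexx ?orbT //.
    apply: (hr2 m); suff <- : e' = e by rewrite -eX.
    have := @gap_uniq x e' X e (proj1 (proj1 hx)) (proj1 (proj1 he)).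
    rewrite eX; have := gap_lt (proj1 (proj1 he)).
    by have := gap_lt (proj1 (proj1 hx)); rewrite eX => l1 l2 /(_ l2 l1) [].
  by apply: (ub r K); rewrite ?le_max ?lexx //; apply: hK hm.
have r1' : 1 < r by lra.
have K0 : K <= `|K| by rewrite ler_norm.
exists r, (`|K| + (2 * C)%:R); split=> //; first exact: ltW.
move=> y f hg; have C2 : 0 <= (2 * C)%:R :> rat by [].
have y0' : 0 <= y%:R :> rat by [].
have yr : y%:R <= r * y%:R by rewrite ler_peMl // ltW.
have Kp : 0 <= `|K| by [].
have [hs|hl] := leqP (f - y) (2 * C).
  have : (f <= y + 2 * C)%N by rewrite -leq_subLR.
  by rewrite -(ler_nat rat) natrD; lra.
have [x [e [m [hroot hm]]]] := big_gap_root (conj hg hl).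
have [xX|xX] := ltnP x X; first by have := hK _ _ hroot xX _ _ _ hm; lra.
have [[hxe hx2] hx3] := hroot.
have [b1 b2] := reach_bounds (gap_lt hxe) hm.
suff : (f - y)%:R <= (r1 - 1) * y%:R :> rat.
  rewrite natrB; last exact: ltnW (gap_lt hg).
  have : (r1 - 1) * y%:R <= (r - 1) * y%:R by rewrite ler_wpM2r // lerD2r.
  by lra.
have b3 : (f - y <= d ^ m * (L + C))%N.
  by apply: leq_trans b2 _; rewrite leq_mul2l leq_add2r hx3 orbT.
move: b1 b3; rewrite -!(ler_nat rat) natrD !natrM => b1 b3.
apply: le_trans b3 _.
have dm0 : 0 <= (d ^ m)%:R :> rat by [].
apply: le_trans (ler_wpM2l dm0 hX) _.
rewrite mulrCA ler_wpM2l ?subr_ge0 ?(ltW r11) //.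
have : (d ^ m)%:R * X%:R <= (d ^ m)%:R * x%:R :> rat by rewrite ler_wpM2l // ler_nat.
by rewrite mulrBr; lra.
Qed.
End GapGrowth.

(** * Multiplication of Laurent series by polynomials *)

(* Qualified because mathcomp.algebra.poly also exports a coef_mul_poly. *)
Notation lmulp := Pilot.Defs.coef_mul_poly.

Section LaurentSeries.
Implicit Types (P Q S : {poly rat}) (c : int -> rat).

Lemma lmulpE P c n k : (size P <= k)%N ->
  lmulp P c n = \sum_(i < k) P`_i * c (n - i%:Z).
Proof.
move=> hk; rewrite /Pilot.Defs.coef_mul_poly.
rewrite (big_ord_widen k (fun i => P`_i * c (n - i%:Z))) // big_mkcond /=.
apply: eq_bigr => i _; case: ltnP => // hi.
by rewrite nth_default // mul0r.
Qed.

Lemma lmulpD P Q c n :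
  lmulp (P + Q) c n = lmulp P c n + lmulp Q c n.
Proof.
set k := maxn (size P) (size Q).
rewrite !(@lmulpE _ _ _ k) ?leq_maxl ?leq_maxr ?size_polyD //.
by rewrite -big_split; apply: eq_bigr => i _; rewrite coefD mulrDl.
Qed.

Lemma lmulpZ a P c n :
  lmulp (a *: P) c n = a * lmulp P c n.
Proof.
rewrite (@lmulpE (a *: P) _ _ (size P)) ?size_scale_leq // mulr_sumr.
by apply: eq_bigr => i _; rewrite coefZ mulrA.
Qed.

Lemma lmulpC a c n : lmulp a%:P c n = a * c n.
Proof.
rewrite (@lmulpE _ _ _ 1) ?size_polyC_leq1 // big_ord1 coefC /=.
by rewrite subr0.
Qed.

Lemma lmulpMX P c n :
  lmulp (P * 'X) c n = lmulp P c (n - 1).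
Proof.
rewrite (@lmulpE (P * 'X) _ _ (size P).+1); last first.
  by have [->|/size_mulX ->//] := eqVneq P 0; rewrite mul0r size_poly0.
rewrite big_ord_recl coefMX mul0r add0r; apply: eq_bigr => i _.
by rewrite coefMX /=; congr (_ * c _); rewrite /bump /=; lia.
Qed.

Lemma lmulpMXn P c k n :
  lmulp (P * 'X^k) c n = lmulp P c (n - k%:Z).
Proof.
elim: k n => [|k IH] n; first by rewrite mulr1 subr0.
rewrite exprSr mulrA lmulpMX IH; congr lmulp; lia.
Qed.

Lemma lmulp0 c n : lmulp 0 c n = 0.
Proof. by rewrite lmulpC mul0r. Qed.

Lemma lmulpM P Q c n :
  lmulp (P * Q) c n = lmulp P (lmulp Q c) n.
Proof.
elim/poly_ind: P n => [|P a IH] n; first by rewrite mul0r !lmulp0.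
rewrite mulrDl mulrAC mul_polyC !lmulpD !lmulpMX IH.
by rewrite lmulpZ lmulpC.
Qed.

Lemma lmulpDr P c c' n :
  lmulp P (fun n => c n + c' n) n =
  lmulp P c n + lmulp P c' n.
Proof. by rewrite -big_split; apply: eq_bigr => i _; rewrite mulrDr. Qed.

Lemma lmulpNr P c n :
  lmulp P (fun n => - c n) n = - lmulp P c n.
Proof. by rewrite -sumrN; apply: eq_bigr => i _; rewrite mulrN. Qed.

Lemma eq_lmulp P c c' : c =1 c' ->
  lmulp P c =1 lmulp P c'.
Proof. by move=> h n; apply: eq_bigr => i _; rewrite h. Qed.

Definition polyL Q (n : int) : rat := if n is Posz i then Q`_i else 0.

Lemma polyLD P Q n : polyL (P + Q) n = polyL P n + polyL Q n.
Proof. by case: n => [i|i] /=; rewrite ?coefD ?addr0. Qed.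

Lemma polyLN P n : polyL (- P) n = - polyL P n.
Proof. by case: n => [i|i] /=; rewrite ?coefN ?oppr0. Qed.

Lemma polyL_eq0 P : (forall n : int, 0 <= n -> polyL P n = 0) -> P = 0.
Proof. by move=> h; apply/polyP => i; rewrite coef0; exact: (h i). Qed.

Lemma lmulpL P Q n : lmulp P (polyL Q) n = polyL (P * Q) n.
Proof.
elim/poly_ind: P n => [|P a IH] n.
  by rewrite mul0r lmulp0; case: n => //= i; rewrite coef0.
rewrite mulrDl polyLD lmulpD lmulpMX lmulpC IH.
congr (_ + _); last by case: n => [i|i] /=; rewrite ?coefCM ?mulr0.
rewrite mulrAC; case: n => [[|i]|i] /=.
- by rewrite coefMX.
- by rewrite coefMX /= subn1.
- done.
Qed.

Lemma coef_comp_XnE d c k : (0 < d)%N ->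
  coef_comp_Xn d c (d%:Z * k) = c k.
Proof.
by move=> d0; rewrite /coef_comp_Xn dvdz_mulr // mulKz //; lia.
Qed.

Lemma coef_comp_Xn0 d c n : ~~ (d%:Z %| n)%Z -> coef_comp_Xn d c n = 0.
Proof. by rewrite /coef_comp_Xn => /negbTE ->. Qed.

Lemma coef_comp_Xn_mul d P c n : (0 < d)%N ->
  coef_comp_Xn d (lmulp P c) n =
  lmulp (P \Po 'X^d) (coef_comp_Xn d c) n.
Proof.
move=> d0; elim/poly_ind: P n => [|P a IH] n.
  rewrite comp_poly0 lmulp0 /coef_comp_Xn.
  by case: ifP => // _; rewrite lmulp0.
rewrite comp_polyD comp_polyM comp_polyX comp_polyC lmulpD.
rewrite lmulpMXn lmulpC -IH.
have [/dvdzP[k ->]|hn] := boolP (d%:Z %| n)%Z.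
  rewrite [k * _]mulrC; have -> : d%:Z * k - d%:Z = d%:Z * (k - 1) by ring.
  by rewrite !coef_comp_XnE // lmulpD lmulpMX lmulpC.
rewrite !coef_comp_Xn0 ?mulr0 ?addr0 //.
by apply: contra hn => h; rewrite -(subrK d%:Z n) rpredD.
Qed.

Lemma coef_comp_XnL d Q n : (0 < d)%N ->
  coef_comp_Xn d (polyL Q) n = polyL (Q \Po 'X^d) n.
Proof.
move=> d0; case: n => [i|i] /=.
  rewrite coef_comp_poly_Xn // /coef_comp_Xn.
  have -> : (d%:Z %| i%:Z)%Z = (d %| i)%N by [].
  by case: ifP => // _; rewrite divz_nat.
rewrite /coef_comp_Xn; case: ifP => // /dvdzP[k hk].
rewrite hk mulzK; last lia.
by case: k hk => // k hk; have : 0 <= k%:Z * d%:Z by []; lia.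
Qed.

Definition lbd c (t : int) := forall n : int, t < n -> c n = 0.
Definition ldeg c (t : int) := c t != 0 /\ lbd c t.

Definition deg P := (size P).-1.

Lemma size_deg P : P != 0 -> size P = (deg P).+1.
Proof. by rewrite -size_poly_gt0 /deg; case: (size P). Qed.

Lemma lbd_le c t t' : t <= t' -> lbd c t -> lbd c t'.
Proof. by move=> h hc n hn; apply: hc; lia. Qed.

Lemma lbd_mul P c t : lbd c t -> lbd (lmulp P c) (t + (deg P)%:Z).
Proof.
move=> h n hn; rewrite /Pilot.Defs.coef_mul_poly big1 // => i _.
by rewrite h ?mulr0 //; have := ltn_ord i; rewrite /deg in hn *; lia.
Qed.

Lemma lbdB c c' t : lbd c t -> lbd c' t -> lbd (fun n => c n - c' n) t.
Proof. by move=> h h' n hn; rewrite h // h' // subr0. Qed.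

Lemma eq_ldeg c c' t : c =1 c' -> ldeg c t -> ldeg c' t.
Proof.
by move=> e [h1 h2]; split=> [|n hn]; rewrite -e //; apply: h2.
Qed.

Lemma ldeg_mul P c t : P != 0 -> ldeg c t ->
  ldeg (lmulp P c) (t + (deg P)%:Z).
Proof.
move=> P0 [ct h]; split; last exact: lbd_mul.
rewrite (@lmulpE _ _ _ (deg P).+1); last by rewrite leqSpred.
rewrite big_ord_recr /= big1 ?add0r => [|i _].
  by rewrite addrK mulf_neq0 // -/(lead_coef P) lead_coef_eq0.
by rewrite h ?mulr0 //; have := ltn_ord i; lia.
Qed.

Lemma ldeg_uniq c t t' : ldeg c t -> ldeg c t' -> t = t'.
Proof.
move=> [h1 h2] [h1' h2']; apply/eqP; rewrite eq_le !leNgt; apply/andP; split.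
- by apply/negP => /h2'; move/eqP: h1.
- by apply/negP => /h2; move/eqP: h1'.
Qed.

Lemma ldeg_ex c t : lbd c t -> (exists n, c n != 0) ->
  exists2 t' : int, t' <= t & ldeg c t'.
Proof.
move=> hb [n0 hn0].
have n0t : n0 <= t by rewrite leNgt; apply/negP => /hb /eqP; rewrite (negbTE hn0).
have hex : exists k : nat, c (t - k%:Z) != 0.
  by exists `|t - n0|%N; have -> : t - (`|t - n0|%N)%:Z = n0 by lia.
case: (ex_minnP hex) => k hk hmin; exists (t - k%:Z); first lia.
split=> // n hn; apply/eqP/negPn/negP => hcn.
have nt : n <= t by rewrite leNgt; apply/negP => /hb /eqP; rewrite (negbTE hcn).
have := hmin `|t - n|%N; have -> : t - (`|t - n|%N)%:Z = n by lia.
by move/(_ hcn); lia.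
Qed.

Lemma ldeg_comp d c t : (0 < d)%N -> ldeg c t -> ldeg (coef_comp_Xn d c) (d%:Z * t).
Proof.
move=> d0 [h1 h2]; split; first by rewrite coef_comp_XnE.
move=> n hn; have [/dvdzP[k hk]|] := boolP (d%:Z %| n)%Z; last exact: coef_comp_Xn0.
rewrite hk mulrC coef_comp_XnE // h2 //; move: hn; rewrite hk mulrC ltr_pM2r //.
Qed.

(** The bound [t0] ensures that [c] has a degree at all; [ldeg_mul] and uniqueness then determine
    it. *)
Lemma ldeg_mul_inv P c s t0 : P != 0 -> lbd c t0 -> ldeg (lmulp P c) s ->
  ldeg c (s - (deg P)%:Z).
Proof.
move=> P0 hb hs.
have [t _ ht] : exists2 t' : int, t' <= t0 & ldeg c t'.
  apply: ldeg_ex => //; apply: contrapT => hn; case: hs => /negP + _; apply.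
  rewrite /Pilot.Defs.coef_mul_poly big1 // => i _.
  have [->|h] := eqVneq (c (s - i%:Z)) 0; first by rewrite mulr0.
  by case: hn; exists (s - i%:Z).
by have -> : s - (deg P)%:Z = t by rewrite (ldeg_uniq hs (ldeg_mul P0 ht)) addrK.
Qed.
End LaurentSeries.

(** * Convergents of a Laurent series *)

Lemma gcdp_prop (P Q : {poly rat}) (h := gcdp P Q) : P != 0 ->
  [/\ P %/ h != 0, h != 0, coprimep (P %/ h) (Q %/ h),
      h * (P %/ h) = P & h * (Q %/ h) = Q].
Proof.
move=> P0; have h0 : h != 0 by rewrite gcdp_eq0 negb_and P0.
have eP : h * (P %/ h) = P by rewrite mulrC divpK ?dvdp_gcdl.
have eQ : h * (Q %/ h) = Q by rewrite mulrC divpK ?dvdp_gcdr.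
split=> //; last by rewrite coprimep_div_gcd // P0.
by apply: contraNneq P0 => e; rewrite -eP e mulr0.
Qed.

Lemma degM (P Q : {poly rat}) : P != 0 -> Q != 0 ->
  deg (P * Q) = (deg P + deg Q)%N.
Proof.
move=> P0 Q0; by rewrite {1}/deg size_mul // !size_deg // addSn addnS.
Qed.

Lemma deg_comp_Xn d (P : {poly rat}) :
  deg (P \Po 'X^d) = (d * deg P)%N.
Proof. by rewrite /deg size_comp_poly size_polyXn mulnC. Qed.

Lemma comp_Xn_neq0 d (P : {poly rat}) : (0 < d)%N -> P != 0 -> P \Po 'X^d != 0.
Proof.
by move=> d0 P0; rewrite comp_poly_eq0 // size_polyXn.
Qed.

Lemma coprimep_comp_Xn d (P Q : {poly rat}) :
  coprimep P Q -> coprimep (P \Po 'X^d) (Q \Po 'X^d).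
Proof.
move=> /Bezout_eq1_coprimepP [[u v] /= e].
apply/Bezout_eq1_coprimepP; exists (u \Po 'X^d, v \Po 'X^d) => /=.
by rewrite -!comp_polyM -comp_polyD e comp_polyC.
Qed.

Definition sect d j (W : {poly rat}) := \poly_(i < size W) W`_(d * i + j).

(** A series in z^d lives on multiples of [d], so at an index congruent to [j] only the exponents of
    [W] congruent to [j] meet nonzero coefficients. *)
Lemma lmulp_sect d j W c l : (j < d)%N ->
  lmulp (sect d j W) c l = lmulp W (coef_comp_Xn d c) (d%:Z * l + j%:Z).
Proof.
move=> jd; have d0 : (0 < d)%N by lia.
rewrite (@lmulpE (sect d j W) _ _ (size W)) ?size_poly //.
rewrite (@lmulpE W _ _ (size W * d)) ?leq_pmulr //.
rewrite -(big_mkord xpredT (fun i => W`_i * coef_comp_Xn d c (d%:Z * l + j%:Z - i%:Z))).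
rewrite big_nat_mul big_mkord; apply: eq_bigr => i _.
rewrite -{1}[(i * d)%N]add0n big_addn.
have -> : (i.+1 * d - i * d)%N = d by rewrite mulSn addnK.
rewrite big_mkord (bigD1 (Ordinal jd)) //= big1 ?addr0 => [|r hr].
  rewrite coef_poly ltn_ord [(j + _)%N]addnC [(i * d)%N]mulnC; congr (_ * _).
  have -> : d%:Z * l + j%:Z - (d * i + j)%N%:Z = d%:Z * (l - i%:Z) by lia.
  by rewrite coef_comp_XnE.
rewrite coef_comp_Xn0 ?mulr0 //; apply: contra hr => /dvdzP[q hq].
apply/eqP/val_inj => /=; have rd := ltn_ord r.
move: hq; rewrite PoszD PoszM => hq.
have h : j%:Z - r%:Z = (q - l + i%:Z) * d%:Z by rewrite mulrDl mulrBl -hq; ring.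
move: (q - l + i%:Z : int) h => q1 h; have q10 : q1 = 0 by nia.
by move: h; rewrite q10 mul0r; lia.
Qed.

(** With this [j] the leading coefficient of [W] survives. *)
Lemma sect_neq0 d (W : {poly rat}) (j := (deg W %% d)%N) : (0 < d)%N -> W != 0 ->
  sect d j W != 0.
Proof.
move=> d0 W0; apply/eqP => /(congr1 (fun P : {poly rat} => P`_(deg W %/ d))).
rewrite coef0 coef_poly.
have -> : (deg W %/ d < size W)%N by rewrite size_deg // ltnS leq_div.
have -> : (d * (deg W %/ d) + j)%N = deg W by rewrite mulnC -divn_eq.
by move/eqP; rewrite -/(lead_coef W) lead_coef_eq0 (negbTE W0).
Qed.

Lemma deg_sect d j W : (0 < d)%N ->
  (d * deg (sect d j W) <= deg W)%N.
Proof.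
move=> d0; set S := sect d j W.
have [->|S0] := eqVneq S 0; first by rewrite /deg size_poly0 muln0.
have : lead_coef S != 0 by rewrite lead_coef_eq0.
rewrite /lead_coef /S coef_poly -/S; case: ifP => [_|]; last by rewrite eqxx.
set k := (_ + j)%N => hk; have : (k < size W)%N.
  by rewrite ltnNge; apply: contra hk => h; rewrite nth_default.
rewrite /deg => h; apply: leq_trans (leq_addr j _) _; rewrite -/k.
by case: (size W) h.
Qed.

Section Convergents.
Variables (c : int -> rat) (T : int).
Hypothesis cT : lbd c T.
Hypothesis cirr : forall P Q : {poly rat}, P != 0 -> ~ (forall n, lmulp P c n = polyL Q n).

Implicit Types (P Q : {poly rat}).

Definition resid P Q (n : int) : rat := lmulp P c n - polyL Q n.

Lemma lmulp_resid H P Q n : lmulp H (resid P Q) n = resid (H * P) (H * Q) n.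
Proof.
rewrite /resid lmulpDr lmulpNr lmulpL; congr (_ - _).
by rewrite lmulpM.
Qed.

(** Both products contain P P' f, so the series drops out and a polynomial is left. *)
Lemma resid_cross P Q P' Q' n :
  lmulp P' (resid P Q) n - lmulp P (resid P' Q') n = polyL (P * Q' - P' * Q) n.
Proof.
rewrite !lmulp_resid /resid polyLD polyLN (mulrC P'); ring.
Qed.

Lemma lbd_resid P Q : exists t, lbd (resid P Q) t.
Proof.
pose t : int := Num.max (T + (deg P)%:Z) (size Q)%:Z.
exists t; apply: lbdB.
  by apply: lbd_le (lbd_mul cT); rewrite le_max lexx.
move=> [i|i] //= hi; rewrite nth_default //.
have : (size Q)%:Z <= t by rewrite le_max lexx orbT.
by move=> h; have := le_lt_trans h hi; rewrite ltz_nat => /ltnW.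
Qed.

(* [e] is the denominator degree of the convergent that follows P/Q *)
Definition convergent P Q (e : nat) :=
  [/\ P != 0, coprimep P Q, ldeg (resid P Q) (- e%:Z) & (deg P < e)%N].

Lemma convergent_cross P Q e P' Q' e' : convergent P Q e -> convergent P' Q' e' ->
  P * Q' = P' * Q -> deg P = deg P' /\ e = e'.
Proof.
move=> [P0 cPQ hR _] [P0' cPQ' hR' _] eq.
have d1 : P %| P' by rewrite -(Gauss_dvdpl _ cPQ) -eq dvdp_mulr.
have d2' : P' %| P by rewrite -(Gauss_dvdpl _ cPQ') eq dvdp_mulr.
have sz : size P = size P' by apply/eqP; rewrite eqn_leq !dvdp_leq.
have dPP : deg P = deg P' by rewrite /deg sz.
split=> //.
have H := ldeg_mul P0' hR; have H' := ldeg_mul P0 hR'.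
suff : ldeg (lmulp P (resid P' Q')) (- e%:Z + (deg P')%:Z).
  by move/(ldeg_uniq H'); lia.
apply: eq_ldeg H => n; apply/eqP; rewrite -subr_eq0 resid_cross eq subrr.
by case: n => //= i; rewrite coef0.
Qed.

(** The determinant [P * Q' - P' * Q] is a polynomial of negative degree, hence zero. *)
Lemma convergent_uniq P Q e P' Q' e' : convergent P Q e -> convergent P' Q' e' ->
  (deg P < e')%N -> (deg P' < e)%N ->
  deg P = deg P' /\ e = e'.
Proof.
move=> hc hc' h h'; have [_ _ hR _] := hc; have [_ _ hR' _] := hc'.
apply: (convergent_cross hc hc'); apply/eqP; rewrite -subr_eq0; apply/eqP.
apply: polyL_eq0 => n hn; rewrite -resid_cross.
have -> : lmulp P' (resid P Q) n = 0 by apply: (lbd_mul (proj2 hR)); lia.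
have -> : lmulp P (resid P' Q') n = 0 by apply: (lbd_mul (proj2 hR')); lia.
by rewrite subr0.
Qed.

(** [Q0] is the polynomial part of P0 f, and the residual is nonzero because f is not rational.
    Division by the gcd lowers the degree of the denominator and raises the order of the residual by
    the same amount, so both bounds persist. *)
Lemma convergent_reduce P0 (s : nat) : P0 != 0 ->
  (forall n : int, - s%:Z < n -> n < 0 -> lmulp P0 c n = 0) -> (deg P0 < s)%N ->
  exists P Q e, [/\ convergent P Q e, (deg P <= deg P0)%N & (s <= e)%N].
Proof.
move=> P00 hs ds; pose t : int := T + (deg P0)%:Z.
set Q0 := \poly_(i < `|t|.+1) lmulp P0 c i%:Z.
have hQ (n : int) : 0 <= n -> resid P0 Q0 n = 0.
  case: n => // i _; rewrite /resid /= coef_poly; case: ltnP => hi; rewrite ?subrr //.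
  by rewrite subr0 (lbd_mul cT) // -/t; lia.
have hb : lbd (resid P0 Q0) (- s%:Z).
  move=> n hn; have [/hQ//|n0] := lerP 0 n.
  by rewrite /resid hs // sub0r; case: n n0 hn => //= i _ _; rewrite oppr0.
have [] := ldeg_ex hb.
  apply: contrapT => hn; apply: (cirr P00 (Q := Q0)) => n.
  apply/eqP; rewrite -subr_eq0 -/(resid P0 Q0 n).
  by apply: contrapT => /negP h; apply: hn; exists n.
move=> e0 he0 hdeg; have := @gcdp_prop P0 Q0 P00.
set h := gcdp P0 Q0; set P := P0 %/ h; set Q := Q0 %/ h => -[P1 h0 cop eP eQ].
have [t' ht'] := lbd_resid P Q.
have H : ldeg (resid P Q) (e0 - (deg h)%:Z).
  apply: (ldeg_mul_inv h0 ht'); apply: eq_ldeg hdeg => n.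
  by rewrite lmulp_resid eP eQ.
have dP : deg P0 = (deg h + deg P)%N by rewrite -degM // eP.
exists P, Q, `|e0 - (deg h)%:Z|%N; split; [split=> //|by rewrite dP leq_addl|lia].
- by have -> : - `|e0 - (deg h)%:Z|%N%:Z = e0 - (deg h)%:Z by lia.
- by lia.
Qed.

(** Pade approximation: [n] linear conditions on the [n.+1] coefficients of a denominator. *)
Lemma convergent_ex n : exists P Q e,
  [/\ convergent P Q e, (deg P <= n)%N & (n < e)%N].
Proof.
pose M := \matrix_(i < n.+1, j < n) c (- j.+1%:Z - i%:Z).
have : kermx M != 0.
  rewrite -mxrank_eq0 mxrank_ker -lt0n subn_gt0 ltnS.
  exact: rank_leq_col.
rewrite -nz_row_eq0; set v := nz_row _ => v0.
have vM : v *m M = 0 by apply/sub_kermxP; exact: nz_row_sub.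
pose P0 := rVpoly v.
have P00 : P0 != 0.
  by apply: contraNneq v0 => e; rewrite -(rVpolyK v) -/P0 e linear0.
have sz : (deg P0 <= n)%N by rewrite -ltnS -size_deg //; exact: size_poly.
have [||P [Q [e [h1 h2 h3]]]] := @convergent_reduce P0 n.+1 P00.
- case=> [//|k] hk _; have kn : (k < n)%N by lia.
  have := congr1 (fun m : 'rV_n => m 0 (Ordinal kn)) vM.
  rewrite !mxE => <-; rewrite (@lmulpE P0 _ _ n.+1) ?size_deg //.
  by apply: eq_bigr => i _; rewrite coef_rVpoly_ord mxE /= NegzE.
- exact: sz.
- by exists P, Q, e; split=> //; exact: leq_trans h2 sz.
Qed.

Definition gap x e := exists P Q, convergent P Q e /\ deg P = x.

Lemma gap_lt x e : gap x e -> (x < e)%N.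
Proof. by case=> P [Q [[_ _ _ h] <-]]. Qed.

Lemma gap_uniq x e x' e' : gap x e -> gap x' e' -> (x < e')%N -> (x' < e)%N ->
  x = x' /\ e = e'.
Proof. by move=> [P [Q [h <-]]] [P' [Q' [h' <-]]]; exact: (convergent_uniq h h'). Qed.

Lemma gap_ex n : exists x e, [/\ gap x e, (x <= n)%N & (n < e)%N].
Proof.
have [P [Q [e [h1 h2 h3]]]] := convergent_ex n.
by exists (deg P), e; split=> //; exists P, Q.
Qed.

End Convergents.

(** * The functional equation acting on convergents *)

Section Gaps.
Variables (d : nat) (A B : {poly rat}) (c : int -> rat) (T : int).
Hypotheses (d2 : (1 < d)%N) (A0 : A != 0) (B0 : B != 0).
Hypothesis eqc : forall n, lmulp B c n = lmulp A (coef_comp_Xn d c) n.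
Hypothesis cT : lbd c T.
Hypothesis cirr : forall P Q : {poly rat}, P != 0 -> ~ (forall n, lmulp P c n = polyL Q n).

Implicit Types (P Q : {poly rat}).

Local Notation degA := (deg A).
Local Notation degB := (deg B).
Local Notation resid := (resid c).
Local Notation convergent := (convergent c).
Local Notation gap := (gap c).

Definition upU P := (P \Po 'X^d) * B.
Definition upV Q := (Q \Po 'X^d) * A.
Definition upG P Q := gcdp (upU P) (upV Q).

(** In P(z^d) B f - Q(z^d) A the functional equation replaces B f by A f(z^d), and A factors out. *)
Lemma resid_up P Q n :
  resid (upU P) (upV Q) n = lmulp A (coef_comp_Xn d (resid P Q)) n.
Proof.
have d0 : (0 < d)%N by lia.
transitivity (lmulp A (fun n => coef_comp_Xn d (lmulp P c) n +
   - coef_comp_Xn d (polyL Q) n) n); last first.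
  apply: eq_lmulp => k; rewrite /coef_comp_Xn; case: ifP => // _.
rewrite lmulpDr lmulpNr (eq_lmulp _ (fun n => coef_comp_XnL Q n d0)) lmulpL.
rewrite (eq_lmulp _ (fun n => coef_comp_Xn_mul P c n d0)) -lmulpM.
rewrite /resid /upU /upV (lmulpM (P \Po 'X^d) B c) (eq_lmulp _ eqc) -lmulpM.
by rewrite (mulrC A) (mulrC A).
Qed.

Lemma convergent_up P Q e (h := upG P Q) (g := deg h)
    (P' := upU P %/ h) (Q' := upV Q %/ h) :
  convergent P Q e -> (degA + degB < d * (e - deg P))%N ->
  exists2 e', convergent P' Q' e' & up_step d degA degB (deg P) e (deg P') e' g.
Proof.
move=> [P0 cop hR Pe] hbig; have d0 : (0 < d)%N by lia.
have U0 : upU P != 0 by rewrite mulf_neq0 // comp_Xn_neq0.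
have := @gcdp_prop (upU P) (upV Q) U0.
rewrite -/(upG P Q) -/h -/P' -/Q' => -[P1 h0 cop' eP eQ].
have [t' ht'] := lbd_resid cT P' Q'.
have H : ldeg (resid P' Q') (d%:Z * (- e%:Z) + degA%:Z - g%:Z).
  apply: (ldeg_mul_inv h0 ht'); apply: eq_ldeg (ldeg_mul A0 (ldeg_comp d0 hR)) => n.
  by rewrite lmulp_resid eP eQ resid_up.
have dP : (g + deg P' = d * deg P + degB)%N.
  by rewrite -degM // eP /upU degM // ?comp_Xn_neq0 // deg_comp_Xn.
(* P(z^d) and Q(z^d) are still coprime, and [h] divides A B times each of them; by Bezout it divides
   A B. *)
have gle : (g <= degA + degB)%N.
  have hA : h %| A * B * (P \Po 'X^d).
    by rewrite -mulrA (mulrC B) dvdp_mull // dvdp_gcdl.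
  have hA' : h %| A * B * (Q \Po 'X^d).
    by rewrite mulrAC (mulrC A) dvdp_mulr // dvdp_gcdr.
  have /dvdp_leq : h %| A * B.
    have /Bezout_eq1_coprimepP [[u v] /= e1] := coprimep_comp_Xn d cop.
    rewrite -[A * B]mulr1 -e1 mulrDr (mulrC u) (mulrC v) !mulrA.
    by rewrite dvdp_addr dvdp_mulr.
  rewrite mulf_neq0 // => /(_ isT) hs; rewrite -degM //.
  by rewrite -ltnS /g -!size_deg // mulf_neq0.
have he : (degA + deg P' < d * e + g)%N by nia.
exists (d * e + g - degA)%N; last by split; lia.
split=> //; last by lia.
have -> : - (d * e + g - degA)%N%:Z = d%:Z * (- e%:Z) + degA%:Z - g%:Z by lia.
by [].
Qed.

(** The coefficients of S f are coefficients of P A f(z^d) = P B f, which vanish on a long range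
    because P f is nearly a polynomial. So [S] yields a convergent, whose image overlaps the given
    gap and therefore equals it. *)
Lemma gap_down x e : gap x e -> (2 * (degA + degB) < e - x)%N ->
  exists x1 e1 g, [/\ gap x1 e1, up_step d degA degB x1 e1 x e g &
    (degA + degB < d * (e1 - x1))%N].
Proof.
move=> hg hbig; have [P [Q [[P0 cop hR Pe] dP]]] := hg.
have d0 : (0 < d)%N by lia.
set W := P * A; have W0 : W != 0 by rewrite mulf_neq0.
set j := (deg W %% d)%N; have jd : (j < d)%N by rewrite ltn_mod.
set S := sect d j W; have S0 : S != 0 by exact: sect_neq0.
have dS : (d * deg S <= x + degA)%N.
  by rewrite -dP -degM //; exact: deg_sect.
(* [m] is the ceiling of (e - deg B) / d: the range on which P B f vanishes, shrunk by the
   section. *)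
have [m hm] : exists m : nat, (e - degB <= d * m /\ d * m < e - degB + d)%N.
  exists ((e - degB + d.-1) %/ d)%N.
  have := divn_eq (e - degB + d.-1) d; have := ltn_pmod (e - degB + d.-1) d0.
  by nia.
have hB (n : int) : - (e - degB)%N%:Z < n -> n < 0 -> lmulp (P * B) c n = 0.
  move=> h1 h2; rewrite mulrC lmulpM.
  have -> : lmulp B (lmulp P c) n = lmulp B (resid P Q) n + lmulp B (polyL Q) n.
    by rewrite -lmulpDr; apply: eq_lmulp => k; rewrite /resid subrK.
  rewrite lmulpL (lbd_mul (proj2 hR)) ?add0r; last by lia.
  by case: n h1 h2.
have [||P1 [Q1 [e1 [hc h1 h2]]]] := @convergent_reduce c T cT cirr S m S0.
- move=> l hl1 hl2; rewrite lmulp_sect // /W lmulpM -(eq_lmulp _ eqc) -lmulpM.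
  by apply: hB; nia.
- by nia.
have b1 : (degA + degB < d * (e1 - deg P1))%N by nia.
have [e2 hc2 hu] := convergent_up hc b1.
set P2 := _ %/ _ in hc2 hu; set Q2 := _ %/ _ in hc2.
case: (hu) => u1 u2 u3.
have [|||E1 E2] := @gap_uniq c x e (deg P2) e2 hg.
- by exists P2, Q2.
- by nia.
- by nia.
exists (deg P1), e1, (deg (upG P1 Q1)).
split; [by exists P1, Q1|by rewrite E1 E2|exact: b1].
Qed.
Definition up_triple (t : {poly rat} * {poly rat} * nat) :=
  let: (P, Q, e) := t in let h := upG P Q in
  (upU P %/ h, upV Q %/ h, (d * e + deg h - degA)%N).

Lemma gap_chain x e : gap x e -> (2 * (degA + degB).+1 < e - x)%N ->
  exists X E g : nat -> nat, [/\ X 0%N = x, E 0%N = e, forall m, gap (X m) (E m),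
    forall m, up_step d degA degB (X m) (E m) (X m.+1) (E m.+1) (g m) & evper g].
Proof.
move=> [P0 [Q0 [hc0 <-]]] hbig.
pose st m := iter m up_triple (P0, Q0, e).
pose P m := (st m).1.1; pose Q m := (st m).1.2; pose E m := (st m).2.
pose g m := deg (upG (P m) (Q m)).
have PS m : P m.+1 = upU (P m) %/ upG (P m) (Q m).
  by rewrite /P /Q /st iterS; case: (iter _ _ _) => [[]].
have QS m : Q m.+1 = upV (Q m) %/ upG (P m) (Q m).
  by rewrite /P /Q /st iterS; case: (iter _ _ _) => [[]].
have ES m : E m.+1 = (d * E m + g m - degA)%N.
  by rewrite /g /E /P /Q /st iterS; case: (iter _ _ _) => [[]].
have inv m : convergent (P m) (Q m) (E m) /\ (2 * (degA + degB).+1 < E m - deg (P m))%N /\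
    up_step d degA degB (deg (P m)) (E m) (deg (P m.+1)) (E m.+1) (g m).
  suff H : convergent (P m) (Q m) (E m) /\ (2 * (degA + degB).+1 < E m - deg (P m))%N.
    have [hc hb] := H; split=> //; split=> //.
    have [|e' _ [u1 u2 u3]] := convergent_up hc; first by nia.
    by rewrite PS ES; split=> //; rewrite /g; lia.
  elim: m => [|m [hc hb]]; first by [].
  have [|e' hc' [u1 u2 u3]] := convergent_up hc; first by nia.
  have eE : E m.+1 = e' by rewrite ES /g; lia.
  have [_ _ _ lt1] := hc; have [_ _ _ lt2] := hc'.
  by rewrite PS QS eE; split=> //; nia.
exists (fun m => deg (P m)), E, g; split=> // [m|m|].
- by exists (P m), (Q m); have [] := inv m.
- by have [_ []] := inv m.
have P_neq0 m : P m != 0 by have [[]] := inv m.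
(* Multiplicities need nonzero polynomials. If [Q m] vanished, so would [Q m.+1], and both
   denominators would be constant by coprimality; two convergents of denominator degree 0 share
   their [e], yet here [e] has to grow. *)
have Q_neq0 m : Q m != 0.
  apply/eqP => Qm0.
  have const k : Q k = 0 -> deg (P k) = 0%N.
    move=> Qk; have [[_ + _ _] _] := inv k.
    by rewrite Qk coprimep0 /deg => /eqp_size ->; rewrite size_poly1.
  have Qm1 : Q m.+1 = 0 by rewrite QS /upV Qm0 comp_poly0 mul0r div0p.
  have [[hc1 [hb1 _]] [hc2 [hb2 _]]] := (inv m, inv m.+1).
  have [||_ eE] := @convergent_uniq c _ _ _ _ _ _ hc1 hc2.
  - by rewrite const //; lia.
  - by rewrite const //; lia.
  have [_ [_ [u1 u2 u3]]] := inv m.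
  by move: u1 hb1; rewrite !const // -eE in u2 *; nia.
(* The multiplicity argument needs an algebraically closed field; degrees, gcds and coprimality are
   preserved by the embedding. *)
pose emb := map_poly (ratr : rat -> algC).
have -> : g = fun i => (size (emb (upG (P i) (Q i)))).-1.
  by apply/funext => i; rewrite /g /deg size_map_poly.
have embE (U : {poly rat}) : emb (U \Po 'X^d) = emb U \Po 'X^d.
  by rewrite /emb map_comp_poly map_polyXn.
have hdiv i : upG (P i) (Q i) * P i.+1 = upU (P i) /\ upG (P i) (Q i) * Q i.+1 = upV (Q i).
  have U0 : upU (P i) != 0 by rewrite mulf_neq0 // comp_Xn_neq0 //; lia.
  by have [_ _ _] := gcdp_prop (upV (Q i)) U0; rewrite -/(upG _ _) -PS -QS.
apply: (@evper_size_gcdp algC d (emb A) (emb B) (fun i => emb (P i)) (fun i => emb (Q i))).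
- by lia.
- by rewrite map_poly_eq0.
- by rewrite map_poly_eq0.
- by move=> i; rewrite map_poly_eq0.
- by move=> i; rewrite map_poly_eq0.
- by move=> i; rewrite coprimep_map; have [[]] := inv i.
- by move=> i; rewrite -!embE -!rmorphM -gcdp_map.
- by move=> i; rewrite -!embE -!rmorphM (proj1 (hdiv i)).
- by move=> i; rewrite -!embE -!rmorphM (proj2 (hdiv i)).
Qed.

Lemma convergent_ratio : exists r K : rat, [/\ 1 <= r,
  forall Y : nat, exists P Q e,
    [/\ convergent P Q e, (Y <= deg P)%N & r * (deg P)%:R - K <= e%:R] &
  forall P Q e, convergent P Q e -> e%:R <= r * (deg P)%:R + K].
Proof.
have [r [K [r1 [K' att] hK]]] := gap_ratio d2 (@gap_lt c) (@gap_uniq c) (gap_ex cT cirr) gap_down gap_chain.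
exists r, (`|K| + `|K'|); split=> // [Y|P Q e hc].
  have [x [e [[P [Q [hc dP]]] h2 h3]]] := att Y.
  exists P, Q, e; split; rewrite ?dP //; have := ler_norm K'.
  by have := normr_ge0 K; lra.
have /hK : gap (deg P) e by exists P, Q.
by have := ler_norm K; have := normr_ge0 K'; lra.
Qed.

End Gaps.

(** * Evaluation *)

Section LaurentEval.
Variable R : realType.
Implicit Types (c : int -> rat) (x v : R) (P Q : {poly rat}).

Definition lterm c (K : int) x (k : nat) : R :=
  ratr (c (K - k%:Z)) * x ^ (K - k%:Z).

(** The starting exponent [K] is left open so that series of different degrees can be added; raising
    it only prepends zero terms. *)
Definition has_eval c x v :=
  exists K, lbd c K /\ series (lterm c K x) @ \oo --> v.

Lemma seriesS (u : R^nat) n : series u n.+1 = series u n + u n.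
Proof. by rewrite /series /= big_nat_recr. Qed.

Lemma lterm_step c K x v : lbd c K ->
  series (lterm c (K + 1) x) @ \oo --> v <-> series (lterm c K x) @ \oo --> v.
Proof.
move=> cK; rewrite -(cvg_shiftS (series (lterm c (K + 1) x))).
suff -> : [sequence series (lterm c (K + 1) x) n.+1]_n = series (lterm c K x) by [].
apply/funext => n; rewrite /= !seriesEord /= big_ord_recl.
rewrite {1}/lterm cK ?rmorph0 ?mul0r ?add0r; last by lia.
apply: eq_bigr => i _; rewrite /lterm /bump /=.
by have -> : K + 1 - (1 + i)%N%:Z = K - i%:Z by lia.
Qed.

Lemma has_eval_any c K x v : lbd c K -> has_eval c x v ->
  series (lterm c K x) @ \oo --> v.
Proof.
move=> cK [K' [cK' h]].
have up (n : nat) (L : int) : lbd c L ->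
    series (lterm c (L + n%:Z) x) @ \oo --> v <-> series (lterm c L x) @ \oo --> v.
  elim: n L => [|n IH] L cL; first by rewrite addr0.
  have -> : L + n.+1%:Z = (L + 1) + n%:Z by lia.
  rewrite IH ?lterm_step //; apply: lbd_le cL; lia.
have [hK|hK] := lerP K' K.
  have -> : K = K' + `|K - K'|%N%:Z by lia.
  by rewrite up.
by rewrite -(up `|K' - K|%N K cK); have -> : K + `|K' - K|%N%:Z = K' by lia.
Qed.

Lemma has_eval_uniq c x v v' : has_eval c x v -> has_eval c x v' -> v = v'.
Proof.
move=> [K [cK h]] /(has_eval_any cK) h'.
by rewrite -(cvg_lim (@Rhausdorff R) h) -(cvg_lim (@Rhausdorff R) h').
Qed.

Lemma eq_has_eval c c' x v : c =1 c' -> has_eval c x v -> has_eval c' x v.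
Proof. by move=> /funext ->. Qed.

Lemma has_evalD c c' x v v' : has_eval c x v -> has_eval c' x v' ->
  has_eval (fun n => c n + c' n) x (v + v').
Proof.
move=> h h'; have [K [cK _]] := h; have [K' [cK' _]] := h'.
pose L : int := `|K|%N%:Z + `|K'|%N%:Z.
have cL : lbd c L by apply: lbd_le cK; rewrite /L; lia.
have cL' : lbd c' L by apply: lbd_le cK'; rewrite /L; lia.
exists L; split; first by move=> n hn; rewrite cL // cL' // addr0.
have -> : series (lterm (fun n => c n + c' n) L x) =
    series (lterm c L x) \+ series (lterm c' L x).
  apply/funext => n; rewrite /= !seriesEord /= -big_split /=.
  by apply: eq_bigr => i _; rewrite /lterm rmorphD mulrDl.
by apply: cvgD; apply: has_eval_any.
Qed.

Lemma has_evalZ a c x v : has_eval c x v ->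
  has_eval (fun n => a * c n) x (ratr a * v).
Proof.
move=> [K [cK h]]; exists K; split; first by move=> n hn; rewrite cK // mulr0.
have -> : series (lterm (fun n => a * c n) K x) =
    (fun n => ratr a * series (lterm c K x) n).
  apply/funext => n; rewrite /= !seriesEord /= mulr_sumr.
  by apply: eq_bigr => i _; rewrite /lterm rmorphM mulrA.
exact: cvgMr.
Qed.

Lemma has_evalX c x v : x != 0 -> has_eval c x v ->
  has_eval (fun n => c (n - 1)) x (x * v).
Proof.
move=> x0 [K [cK h]]; exists (K + 1); split; first by move=> n hn; rewrite cK //; lia.
have -> : series (lterm (fun n => c (n - 1)) (K + 1) x) =
    (fun n => x * series (lterm c K x) n).
  apply/funext => n; rewrite /= !seriesEord /= mulr_sumr.
  apply: eq_bigr => i _; rewrite /lterm mulrCA.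
  have -> : K + 1 - i%:Z - 1 = K - i%:Z by lia.
  have -> : K + 1 - i%:Z = 1 + (K - i%:Z) by lia.
  by rewrite expfzDr // expr1z.
exact: cvgMr.
Qed.

Definition evalR P x : R := (map_poly ratr P).[x].

Lemma has_eval_lmulp P c x v : x != 0 -> has_eval c x v ->
  has_eval (lmulp P c) x (evalR P x * v).
Proof.
move=> x0 hv; elim/poly_ind: P => [|P a IH].
  apply: (@eq_has_eval (fun n => 0 * c n)) => [n|]; first by rewrite lmulp0 mul0r.
  by have := has_evalZ 0 hv; rewrite /evalR !rmorph0 horner0.
apply: (@eq_has_eval (fun n => lmulp P c (n - 1) + a * c n)) => [n|].
  by rewrite lmulpD lmulpMX lmulpC.
have -> : evalR (P * 'X + a%:P) x * v = x * (evalR P x * v) + ratr a * v.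
  by rewrite /evalR rmorphD rmorphM /= map_polyX map_polyC /= hornerD hornerM hornerX hornerC; ring.
by apply: has_evalD (has_evalX x0 IH) (has_evalZ a hv).
Qed.

Lemma has_eval_polyL Q x : x != 0 -> has_eval (polyL Q) x (evalR Q x).
Proof.
move=> x0; suff h : has_eval (polyL 1) x 1.
  apply: (@eq_has_eval (lmulp Q (polyL 1))) => [n|]; first by rewrite lmulpL mulr1.
  by rewrite -[evalR _ _]mulr1; apply: has_eval_lmulp.
exists 0; split; first by move=> [n|n] //=; rewrite coef1; case: n.
rewrite -(cvg_shiftS (series _)).
have -> : [sequence series (lterm (polyL 1) 0 x) n.+1]_n = cst 1; last exact: cvg_cst.
apply/funext => n; rewrite /= !seriesEord /= big_ord_recl big1 ?addr0 /lterm /=.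
  by rewrite coef1 rmorph1 mul1r.
by move=> i _; rewrite /bump /= rmorph0 mul0r.
Qed.

Lemma has_eval_resid P Q c x v : x != 0 -> has_eval c x v ->
  has_eval (resid c P Q) x (evalR P x * v - evalR Q x).
Proof.
move=> x0 hv.
have -> : evalR P x * v - evalR Q x = evalR P x * v + ratr (- 1) * evalR Q x.
  by rewrite rmorphN1 mulN1r.
apply: (@eq_has_eval (fun n => lmulp P c n + - 1 * polyL Q n)) => [n|].
  by rewrite mulN1r.
apply: has_evalD (has_eval_lmulp P x0 hv) (has_evalZ (- 1) (has_eval_polyL Q x0)).
Qed.

Lemma has_eval_comp d c x v : (0 < d)%N -> x != 0 -> has_eval c (x ^+ d) v ->
  has_eval (coef_comp_Xn d c) x v.
Proof.
move=> d0 x0 [K [cK h]]; exists (d%:Z * K); split.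
  move=> n hn; have [/dvdzP[k hk]|] := boolP (d%:Z %| n)%Z; last exact: coef_comp_Xn0.
  rewrite hk mulrC coef_comp_XnE // cK //.
  by move: hn; rewrite hk mulrC ltr_pM2r // ltz_nat.
(* Among the first [n] terms only every [d]-th can be nonzero, beginning with the first, so they
   amount to the first ceiling of n / d terms of the series at [x ^+ d]. *)
have -> : series (lterm (coef_comp_Xn d c) (d%:Z * K) x) =
    series (lterm c K (x ^+ d)) \o (fun n => (n + d.-1) %/ d)%N.
  apply/funext => n /=; elim: n => [|n IH].
    by rewrite add0n divn_small ?prednK // !seriesEord /= !big_ord0.
  rewrite seriesS IH addSnnS prednK // (divnDr n (dvdnn d)) divnn d0 addn1.
  have [/dvdnP[k hk]|hn] := boolP (d %| n)%N.
    have -> : (n %/ d)%N = k by rewrite hk mulnK.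
    have -> : ((n + d.-1) %/ d)%N = k.
      by rewrite hk divnMDl // divn_small ?addn0 // prednK.
    rewrite seriesS; congr (_ + _); rewrite /lterm.
    have -> : d%:Z * K - n%:Z = d%:Z * (K - k%:Z) by rewrite hk; lia.
    by rewrite coef_comp_XnE // exprnP exprz_exp.
  have -> : ((n %/ d).+1 = (n + d.-1) %/ d)%N.
    have r0 : (0 < n %% d)%N by rewrite lt0n.
    rewrite {2}(divn_eq n d) -addnA divnMDl //.
    have -> : (n %% d + d.-1)%N = ((n %% d).-1 + d)%N by lia.
    have hp : ((n %% d).-1 < d)%N by apply: leq_ltn_trans (leq_pred _) (ltn_pmod n d0).
    by rewrite (divnDr _ (dvdnn d)) divnn d0 (divn_small hp) add0n addn1.
  rewrite /lterm coef_comp_Xn0 ?rmorph0 ?mul0r ?addr0 //.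
  apply: contra hn => hd; have : (d%:Z %| n%:Z)%Z; last by [].
  have -> : n%:Z = d%:Z * K - (d%:Z * K - n%:Z) by ring.
  by rewrite rpredB // dvdz_mulr.
apply: cvg_comp h; apply: (@cvg_comp _ _ _ (fun n => n + d.-1)%N (fun n => n %/ d)%N).
  exact: cvg_addnr.
exact: cvg_divnr.
Qed.

Definition lgrowth (rho : R) c :=
  exists M, forall k : nat, `|ratr (c (- k%:Z))| <= M * rho ^+ k.

Lemma lgrowthB rho c c' : lgrowth rho c -> lgrowth rho c' ->
  lgrowth rho (fun n => c n - c' n).
Proof.
move=> [M h] [M' h']; exists (M + M') => k.
by rewrite rmorphB mulrDl; apply: le_trans (ler_normB _ _) (lerD (h k) (h' k)).
Qed.

Lemma lgrowth_lmulp P rho c : 0 <= rho -> lgrowth rho c -> lgrowth rho (lmulp P c).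
Proof.
move=> r0 [M h]; exists (\sum_(i < size P) `|ratr P`_i| * (M * rho ^+ i)) => k.
rewrite rmorph_sum mulr_suml; apply: le_trans (ler_norm_sum _ _ _) _.
apply: ler_sum => i _; rewrite rmorphM normrM -!mulrA ler_wpM2l //.
have -> : - k%:Z - i%:Z = - (i + k)%N%:Z by lia.
by apply: le_trans (h _) _; rewrite exprD.
Qed.

Lemma lgrowth_polyL Q rho : 0 <= rho -> lgrowth rho (polyL Q).
Proof.
move=> r0; exists `|ratr Q`_0| => -[|k]; first by rewrite mulr1.
by rewrite -NegzE /= rmorph0 normr0 mulr_ge0 ?exprn_ge0.
Qed.

(** Comparison with a geometric series of ratio rho / beta. The bound is uniform in [x], which later
    runs through the numbers b^(d^m). *)
Lemma has_eval_bound c (e : nat) (rho beta : R) : lgrowth rho c -> 0 < rho < beta ->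
  lbd c (- e%:Z) ->
  exists M, forall x v, beta <= `|x| -> has_eval c x v -> `|v| * `|x| ^+ e <= M.
Proof.
move=> [M hM] /andP[r0 rb] ce.
pose q := rho / beta; have b0 : 0 < beta := lt_trans r0 rb.
have q0 : 0 <= q by rewrite divr_ge0 // ltW.
have q1 : q < 1 by rewrite ltr_pdivrMr // mul1r.
have M0 : 0 <= M by have := hM 0; rewrite mulr1; apply: le_trans.
exists (M * rho ^+ e / (1 - q)) => x v bx /(has_eval_any ce) hv.
have x0 : 0 < `|x| := lt_le_trans b0 bx.
rewrite -ler_pdivlMr ?exprn_gt0 //.
rewrite -(cvg_lim (@Rhausdorff R) (cvg_norm hv)).
apply: limr_le; first exact: cvgP (cvg_norm hv).
apply: nearW => n /=; rewrite seriesEord /=.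
apply: le_trans (ler_norm_sum _ _ _) _.
apply: (@le_trans _ _ (\sum_(i < n) M * rho ^+ e / `|x| ^+ e * q ^+ i)).
  apply: ler_sum => i _; rewrite /lterm.
  have -> : - e%:Z - i%:Z = - (e + i)%N%:Z by lia.
  rewrite -exprnN normrM normfV normrX.
  apply: le_trans (ler_wpM2r _ (hM _)) _; first by rewrite invr_ge0 exprn_ge0.
  rewrite !exprD invfM.
  have -> : M * (rho ^+ e * rho ^+ i) * ((`|x| ^+ e)^-1 * (`|x| ^+ i)^-1) =
     M * rho ^+ e / `|x| ^+ e * (rho / `|x|) ^+ i.
    by rewrite exprMn exprVn; ring.
  rewrite ler_wpM2l ?divr_ge0 ?mulr_ge0 ?exprn_ge0 ?(ltW r0) //.
  have qx : 0 <= rho / `|x| by rewrite divr_ge0 // ltW.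
  apply: lerXn2r; rewrite ?nnegrE // /q ler_wpM2l ?(ltW r0) //.
  by rewrite lef_pV2 ?posrE.
rewrite -mulr_sumr.
have -> : \sum_(i < n) q ^+ i = (1 - q ^+ n) / (1 - q).
  have := @geometric_seriesE R 1 q (negbT (lt_eqF q1)).
  move=> /(congr1 (fun u => u n)); rewrite seriesEord /= mul1r => <-.
  by apply: eq_bigr => i _; rewrite /geometric /= mul1r.
have -> : M * rho ^+ e / `|x| ^+ e * ((1 - q ^+ n) / (1 - q)) =
  M * rho ^+ e / (1 - q) / `|x| ^+ e * (1 - q ^+ n) by ring.
apply: ler_piMr; last by rewrite lerBlDr lerDl exprn_ge0.
apply: divr_ge0; last exact: exprn_ge0.
apply: divr_ge0; last by rewrite subr_ge0 ltW.
by apply: mulr_ge0 => //; apply: exprn_ge0; exact: ltW.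
Qed.

Lemma lbd_lcoef f : lbd (lcoef f) (size (lpoly f))%:Z.
Proof. by move=> [n|n] // hn; rewrite /= nth_default // ltnW // -ltz_nat. Qed.

Lemma has_eval_leval f x : x != 0 -> lconverges f x -> has_eval (lcoef f) x (leval f x).
Proof.
move=> x0 hx.
apply: (@eq_has_eval (fun n => polyL (lpoly f) n + (if n is Negz k then ltail f k else 0))).
  by move=> [n|n] /=; rewrite ?addr0 ?add0r.
apply: has_evalD; first exact: has_eval_polyL.
exists (- 1%:Z); split; first by case.
have -> : series (lterm (fun n => if n is Negz k then ltail f k else 0) (- 1%:Z) x) =
    (fun n => x^-1 * pseries (ltailR R f) x^-1 n).
  apply/funext => n; rewrite /pseries /= !seriesEord /= mulr_sumr.
  apply: eq_bigr => i _; rewrite /lterm /ltailR.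
  have -> : - 1%:Z - i%:Z = Negz i by lia.
  by rewrite NegzE -exprnN mulrCA exprS invfM exprVn.
exact: cvgMr.
Qed.

(** At a point strictly between the radius and |x| the series converges, so its terms are bounded;
    that point serves as [rho]. *)
Lemma lgrowth_lcoef f (x : R) : in_convergence_domain f x ->
  exists2 rho, 0 < rho < `|x| & lgrowth rho (lcoef f).
Proof.
move=> [r [r0 rx hr]]; pose y := (r + `|x|) / 2.
have ry : r < y by rewrite /y; lra.
have y0 : 0 < y by lra.
have yx : y < `|x| by rewrite /y; lra.
exists y; first by rewrite y0.
have /hr /cvg_series_bounded [N [_ hN]] : r < `|y| by rewrite gtr0_norm.
have {}hN k : `|ltailR R f k * y^-1 ^+ k| <= N + 1 by apply: hN; rewrite ?ltrDl.
have N0 : 0 <= N + 1 by apply: le_trans (hN 0%N).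
exists (`|ratr (lpoly f)`_0| + (N + 1) / y) => -[|k].
  by rewrite mulr1 /= lerDl divr_ge0 // ltW.
rewrite -NegzE /=; have := hN k; rewrite normrM exprVn normfV normrX (gtr0_norm y0).
rewrite ler_pdivrMr ?exprn_gt0 // => h; apply: le_trans h _.
have -> : forall a, (a + (N + 1) / y) * y ^+ k.+1 = a * y ^+ k.+1 + (N + 1) * y ^+ k.
  by move=> a; rewrite exprS; field; rewrite gt_eqF.
by rewrite lerDr mulr_ge0 // exprn_ge0 // ltW.
Qed.
End LaurentEval.

(** * Series convergent across the unit circle *)

Lemma rat_poly_int_multiple (P : {poly rat}) :
  exists2 a : int, a != 0 & a%:~R *: P \is a polyOver Num.int.
Proof.
have [q [a a0 eP]] := rat_poly_scale P; exists a => //.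
rewrite eP scalerA mulfV ?intr_eq0 // scale1r.
by apply/polyOverP => i; rewrite coef_map /= intr_int.
Qed.

Lemma ratr_int_ge1 (R : realType) (x : rat) : x \is a Num.int -> x != 0 ->
  1 <= `|ratr x : R|.
Proof.
move=> /intrP[m ->]; rewrite intr_eq0 ratr_int => m0.
by rewrite norm_intr_ge1 ?intr_int // intr_eq0.
Qed.

Lemma norm_ratr_monomial (R : realType) (l y t z : rat) n :
  `|ratr (l * y ^+ n * (t * z))| =
  `|ratr l| * `|ratr y| ^+ n * (`|ratr t| * `|ratr z|) :> R.
Proof.
rewrite -normrX -rmorphXn /= -!normrM -!rmorphM.
by [].
Qed.

Lemma ler_mul_rearrange (R : realType) (l bk bs t w M ek : R) :
  0 <= l -> 0 <= bk -> 0 <= bs -> 0 <= t -> w <= M * ek ->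
  l * (bk * bs) * (t * w) <= l * bs * t * M * (bk * ek).
Proof.
move=> l0 bk0 bs0 t0 hw.
have -> : l * (bk * bs) * (t * w) = l * bk * bs * t * w by ring.
have -> : l * bs * t * M * (bk * ek) = l * bk * bs * t * (M * ek) by ring.
by rewrite ler_wpM2l // !mulr_ge0.
Qed.

Lemma geometric_small (R : realType) (z M : R) : 0 <= z < 1 ->
  exists n0, forall n, (n0 <= n)%N -> M * z ^+ n < 1.
Proof.
move=> /andP[z0 z1].
have /cvgrPdist_lt /(_ 1 ltr01) [n0 _ h] : geometric M z @ \oo --> (0 : R).
  by apply: cvg_geometric; rewrite ger0_norm.
exists n0 => n /h /=; rewrite sub0r normrN /geometric /=.
by apply: le_lt_trans; exact: ler_norm.
Qed.

(** The relation at [b] reads P(b) v = Q(b). As [v] is irrational, P(b) = 0, hence Q(b) = 0, and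
    cancelling z - b leaves a relation of smaller degree. *)
Lemma not_rational_function (R : realType) (c : int -> rat) (b : int) (v : R) T :
  b != 0 -> lbd c T -> has_eval c (b%:~R : R) v -> irrational v ->
  forall P Q, P != 0 -> ~ (forall n, lmulp P c n = polyL Q n).
Proof.
move=> b0 cT hv hirr P Q P0.
have [n] := ubnP (size P); elim: n P P0 Q => // n IH P P0 Q hn eqPQ.
have x0 : (b%:~R : R) != 0 by rewrite intr_eq0.
have evb (S : {poly rat}) : evalR S (b%:~R : R) = ratr S.[b%:~R].
  by rewrite /evalR -(ratr_int R b) horner_map.
have e : evalR P b%:~R * v = evalR Q b%:~R.
  apply: has_eval_uniq (has_eval_polyL Q x0).
  by apply: eq_has_eval (has_eval_lmulp P x0 hv).
rewrite !evb in e; have [rP|rP] := boolP (root P b%:~R); last first.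
  apply: hirr; exists (Q.[b%:~R] / P.[b%:~R]) => //.
  rewrite rmorphM fmorphV /= -e mulrC mulKf // fmorph_eq0.
  by rewrite -rootE.
move: e; rewrite (rootP rP) rmorph0 mul0r => /esym/eqP; rewrite fmorph_eq0 -rootE.
move=> /factor_theorem [Q1 eQ]; have /factor_theorem [P1 eP] := rP.
set X := 'X - _ in eQ eP.
have X0 : X != 0 by rewrite polyXsubC_eq0.
have P10 : P1 != 0 by apply: contraNneq P0 => e; rewrite eP e mul0r.
apply: (IH P1 P10 Q1) => [|k].
  by move: hn; rewrite eP size_Mmonic ?monicXsubC // size_XsubC addn2 /=.
have [t ht] := lbd_resid cT P1 Q1.
apply: contrapT => hne.
have [|t' _ ht'] := ldeg_ex ht.
  by exists k; rewrite /resid subr_eq0; apply/eqP.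
have [/eqP + _] := ldeg_mul X0 ht'; apply.
by rewrite lmulp_resid /resid !(mulrC X) -eP -eQ eqPQ subrr.
Qed.

(** Used for denominators: a coefficient of f(z^d) comes from a coefficient of f whose index is
    smaller in size by the factor [d], hence lies in the range already treated. *)
Lemma comp_index_le (d s k t i : nat) (n q : int) : (1 < d)%N -> (i < s)%N ->
  - (s + k.+1)%N%:Z <= n -> n < - (s + k)%N%:Z -> n + t%:Z - i%:Z = d%:Z * q ->
  - (s + k)%N%:Z <= q.
Proof.
move=> d1 si h1 h2 h; rewrite leNgt; apply/negP => hlt.
have : d%:Z * q <= 2 * q by nia.
by lia.
Qed.

Lemma subz_ord_ge (k s : nat) (i : 'I_s) : - (k + s)%N%:Z <= - k%:Z - i%:Z.
Proof. by have := ltn_ord i; lia. Qed.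

Lemma shift_polyL (c : int -> rat) t k0 : lbd c t ->
  (forall k : nat, (k0 <= k)%N -> c (- k%:Z) = 0) ->
  exists Q, forall n, c (n - k0%:Z) = polyL Q n.
Proof.
move=> ct h; exists (\poly_(i < `|t| + k0 + 1) c (i%:Z - k0%:Z)) => -[i|i] /=.
  rewrite coef_poly; case: ltnP => // hi; apply: ct.
  by move: hi; lia.
have -> : Negz i - k0%:Z = - (i.+1 + k0)%N%:Z by lia.
by rewrite h // leq_addl.
Qed.

Section SmallRadius.
Variables (R : realType) (d : nat) (A B : {poly rat}) (c : int -> rat) (T : int).
Hypotheses (d2 : (1 < d)%N) (A0 : A != 0) (B0 : B != 0).
Hypothesis eqc : forall n, lmulp B c n = lmulp A (coef_comp_Xn d c) n.
Hypothesis cT : lbd c T.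
Hypothesis cirr : forall P Q : {poly rat}, P != 0 -> ~ (forall n, lmulp P c n = polyL Q n).

(** Solving B f = A f(z^d) for [c n] divides once by the leading coefficient of an integral multiple
    of [B], so each further index costs one factor [beta]. *)
Lemma coef_denominators : exists L beta : rat,
  [/\ L \is a Num.int, beta \is a Num.int, L != 0, beta != 0 &
   forall (k : nat) (n : int), - k%:Z <= n -> L * beta ^+ k * c n \is a Num.int].
Proof.
have [a a0 hA] := rat_poly_int_multiple A; have [b b0 hB] := rat_poly_int_multiple B.
pose A' := (a * b)%:~R *: A; pose B' := (a * b)%:~R *: B.
have iA : forall i, A'`_i \is a Num.int.
  by apply/polyOverP; rewrite /A' mulrC intrM -scalerA polyOverZ // intr_int.
have iB : forall i, B'`_i \is a Num.int.
  by apply/polyOverP; rewrite /B' intrM -scalerA polyOverZ // intr_int.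
have B'0 : B' != 0 by rewrite scaler_eq0 negb_or B0 intr_eq0 mulf_neq0.
have eqc' n : lmulp B' c n = lmulp A' (coef_comp_Xn d c) n.
  by rewrite !lmulpZ eqc.
have [L iL [L0 hL]] : exists2 L : rat, L \is a Num.int & L != 0 /\
    forall n, - (size A')%:Z <= n -> L * c n \is a Num.int.
  have h (j : nat) : exists2 L : rat, L \is a Num.int & L != 0 /\
      forall n, T - j%:Z <= n -> L * c n \is a Num.int.
    elim: j => [|j [L iL [L0 hL]]].
      exists (denq (c T))%:~R; rewrite ?intr_int //; split; first by rewrite intr_eq0.
      move=> n; rewrite subr0 le_eqVlt => /orP[/eqP <-|/cT ->]; last by rewrite mulr0 rpred0.
      by rewrite mulrC -numqE intr_int.
    set m := T - j.+1%:Z.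
    exists (L * (denq (c m))%:~R); first by rewrite rpredM ?intr_int.
    split; first by rewrite mulf_neq0 ?intr_eq0.
    move=> n; rewrite le_eqVlt => /orP[/eqP <-|hn].
      by rewrite -mulrA [_ * c m]mulrC -numqE rpredM ?intr_int.
    by rewrite mulrAC rpredM ?intr_int // hL //; move: hn; rewrite /m; lia.
  have [L iL [L0 hL]] := h (`|T|%N + size A')%N; exists L => //; split=> // n hn.
  by apply: hL; lia.
pose beta := lead_coef B'; exists L, beta; split=> //; rewrite ?lead_coef_eq0 //.
  exact: iB.
have key (k : nat) (n : int) : - (size A' + k)%N%:Z <= n ->
    L * beta ^+ k * c n \is a Num.int.
  elim: k n => [|k IH] n hn; first by rewrite mulr1 hL //; move: hn; rewrite addn0.
  have [hk|hk] := lerP (- (size A' + k)%N%:Z) n.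
    by rewrite exprS mulrCA -mulrA rpredM ?IH //; exact: iB.
  have := eqc' (n + (deg B')%:Z).
  rewrite (@lmulpE B' _ _ (deg B').+1) ?size_deg // big_ord_recr /= addrK.
  rewrite -[_`_(deg B')]/beta => /(canRL (addKr _)) e.
  rewrite exprSr mulrA -mulrA e mulrDr rpredD //.
    rewrite mulrN rpredN mulr_sumr rpred_sum // => i _.
    rewrite mulrCA rpredM ?IH //; have := ltn_ord i; lia.
  rewrite /Pilot.Defs.coef_mul_poly mulr_sumr rpred_sum // => i _.
  rewrite mulrCA rpredM //; have hi := ltn_ord i.
  have [/dvdzP[q0 hq0]|hd] := boolP (d%:Z %| n + (deg B')%:Z - i%:Z)%Z; last first.
    by rewrite coef_comp_Xn0 // mulr0 rpred0.
  have [q hq] : exists q : int, n + (deg B')%:Z - i%:Z = d%:Z * q.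
    by exists q0; rewrite hq0 mulrC.
  rewrite hq coef_comp_XnE; last by lia.
  exact: IH (comp_index_le d2 hi hn hk hq).
by move=> k n hn; apply: key; lia.
Qed.

(* P B f = P A f(z^d), and a section modulo d of P A f(z^d) is P' f for a
   section P' of P A. *)
Lemma growth_sharpen (rho : R) P : 0 < rho -> P != 0 -> lgrowth rho (lmulp P c) ->
  exists2 P', P' != 0 & lgrowth (rho ^+ d) (lmulp P' c).
Proof.
move=> r0 P0 hP; have d0 : (0 < d)%N by lia.
have W0 : P * A != 0 by rewrite mulf_neq0.
set j := (deg (P * A) %% d)%N; have jd : (j < d)%N by rewrite ltn_mod.
exists (sect d j (P * A)); first exact: sect_neq0.
have [M hM] := lgrowth_lmulp B (ltW r0) hP.
have e l : lmulp (sect d j (P * A)) c l = lmulp B (lmulp P c) (d%:Z * l + j%:Z).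
  by rewrite lmulp_sect // lmulpM -(eq_lmulp _ eqc) -!lmulpM mulrC.
exists (`|ratr (lmulp (sect d j (P * A)) c 0)| + M / rho ^+ j) => -[|k].
  have M0 : 0 <= M by have := le_trans (normr_ge0 _) (hM 0%N); rewrite mulr1.
  rewrite oppr0 mulr1 lerDl; apply: divr_ge0 => //.
  by apply: exprn_ge0; exact: ltW.
rewrite e; have -> : d%:Z * (- k.+1%:Z) + j%:Z = - (d * k.+1 - j)%N%:Z by nia.
apply: le_trans (hM _) _.
have -> : M * rho ^+ (d * k.+1 - j) = M / rho ^+ j * (rho ^+ d) ^+ k.+1.
  have jk : (j <= d * k.+1)%N by nia.
  rewrite -exprM -{2}(subnK jk) exprD -mulrA; congr (M * _).
  by rewrite mulrCA mulVf ?mulr1 // expf_neq0 // gt_eqF.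
by rewrite ler_wpM2r ?exprn_ge0 ?(ltW r0) // lerDr.
Qed.

Lemma no_small_radius (rho : R) : 0 < rho < 1 -> ~ lgrowth rho c.
Proof.
move=> /andP[r0 r1] hc.
have [L [beta [iL ib L0 b0 hden]]] := coef_denominators.
have iter m : exists2 P, P != 0 & lgrowth (rho ^+ (d ^ m)) (lmulp P c).
  elim: m => [|m [P P0 hP]].
    exists 1; first exact: oner_neq0.
    by rewrite expr1; apply: lgrowth_lmulp => //; exact: ltW.
  have [P' P'0 hP'] := growth_sharpen (exprn_gt0 _ r0) P0 hP.
  by exists P' => //; rewrite expnSr exprM.
(* Since [d ^ N] exceeds [N], after [N] sharpenings the decay outweighs the denominator growth
   [beta]. *)
have [N hN] := @geometric_small R rho `|ratr beta| (introT andP (conj (ltW r0) r1)).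
have [P P0 [M hM]] := iter N.
set eta := rho ^+ (d ^ N) in hM.
have eta0 : 0 < eta by rewrite exprn_gt0.
have hz : 0 <= `|ratr beta| * eta < 1.
  rewrite mulr_ge0 ?(ltW eta0) //= hN //; exact: ltnW (ltn_expl _ d2).
have [p p0 hp] := rat_poly_int_multiple P.
pose P' := p%:~R *: P.
have P'0 : P' != 0 by rewrite scaler_eq0 negb_or P0 intr_eq0 p0.
have [k0 hk0] := geometric_small
  (`|ratr L| * `|ratr beta| ^+ (size P') * `|ratr p%:~R| * M) hz.
(* Cleared of denominators, such a coefficient is an integer of absolute value below 1. *)
have zero (k : nat) : (k0 <= k)%N -> lmulp P' c (- k%:Z) = 0.
  move=> hk; apply/eqP; apply: contraT => ne0.
  have : L * beta ^+ (k + size P') * lmulp P' c (- k%:Z) \is a Num.int.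
    rewrite /Pilot.Defs.coef_mul_poly mulr_sumr rpred_sum // => i _.
    rewrite mulrCA rpredM //; first exact: (polyOverP hp).
    exact: (hden _ _ (subz_ord_ge k i)).
  move=> /(ratr_int_ge1 R); rewrite !mulf_neq0 ?expf_neq0 // => /(_ isT).
  move=> h; exfalso; move: h; apply/negP; rewrite -ltNge.
  apply: le_lt_trans (hk0 k hk).
  rewrite lmulpZ.
  rewrite norm_ratr_monomial.
  rewrite exprD exprMn.
  by apply: ler_mul_rearrange; rewrite ?exprn_ge0.
have [Q hQ] := shift_polyL (lbd_mul cT) zero.
apply: (@cirr (P' * 'X^k0) Q) => [|n]; last by rewrite lmulpMXn hQ.
by rewrite mulf_neq0 // monic_neq0 // monicXn.
Qed.
End SmallRadius.

(** * Irrationality exponents from rational approximations *)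

Lemma denq_divq_le (u v : int) : v != 0 -> denq (u%:~R / v%:~R) <= `|v|.
Proof.
move=> v0; set r := _ / _.
have e : numq r * v = u * denq r.
  apply: (@intr_inj rat); rewrite !intrM.
  have -> : (numq r)%:~R = r * (denq r)%:~R :> rat by rewrite -numqE.
  by rewrite /r mulrAC divfK // intr_eq0.
have h : (denq r %| v)%Z.
  rewrite -(Gauss_dvdzr (m := denq r) (n := numq r)) ?e ?dvdz_mull //.
  by rewrite /coprimez /gcdz gcdnC; apply/eqP; congr Posz; apply/eqP; exact: coprime_num_den.
have := dvdn_leq _ h; rewrite absz_gt0 => /(_ v0).
by have := denq_gt0 r; lia.
Qed.

Lemma finite_bounded_denq (R : realType) (x : R) (D : nat) :
  finite_set [set r : rat | `|x - ratr r| <= 1 /\ denq r <= D%:Z].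
Proof.
pose M := Num.bound ((`|x| + 1) * D%:R).
pose g (p : 'I_(M + M).+1 * 'I_D.+1) : rat := (p.1%:Z - M%:Z)%:~R / (p.2%:Z)%:~R.
apply: (@sub_finite_set _ _ (g @` [set: _])); last exact/finite_image/finite_finset.
move=> r /= [h1 h2].
have d0 := denq_gt0 r.
have hn : `|numq r| <= M%:Z.
  have h3 : `|ratr r : R| <= `|x| + 1.
    rewrite -[ratr r](subrK x) addrC -[ratr r - x]opprB.
    by apply: le_trans (ler_normD _ _) _; rewrite normrN lerD2l.
  have : `|(numq r)%:~R : R| <= M%:R.
    have -> : (numq r)%:~R = ratr r * (denq r)%:~R :> R.
      by rewrite -(ratr_int R (denq r)) -rmorphM -numqE /= ratr_int.
    rewrite normrM; apply: le_trans (ltW (archi_boundP _)).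
      apply: ler_pM => //; rewrite gtr0_norm ?ltr0z // -[D%:R]/(D%:Z%:~R) ler_int //.
    by rewrite mulr_ge0 ?addr_ge0.
  by rewrite -intr_norm -[M%:R]/(M%:Z%:~R) ler_int.
have i1 : (absz (numq r + M%:Z)%R < (M + M).+1)%N by lia.
have i2 : (absz (denq r) < D.+1)%N by lia.
exists (Ordinal i1, Ordinal i2) => //; rewrite /g /=.
have -> : (absz (numq r + M%:Z)%R)%:Z - M%:Z = numq r by lia.
have -> : (absz (denq r))%:Z = denq r by lia.
by rewrite divq_num_den.
Qed.

Lemma finite_dist_pos (R : realType) (x : R) (S : set rat) : irrational x ->
  finite_set S -> exists2 del : R, 0 < del & forall r, S r -> del <= `|x - ratr r|.
Proof.
move=> hx /finite_seqP[s ->]; elim: s => [|r s [del d0 IH]].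
  by exists 1.
have hr : 0 < `|x - ratr r|.
  rewrite normr_gt0 subr_eq0; apply/eqP => e; apply: hx; exists r => //.
exists (Num.min del `|x - ratr r|); first by rewrite lt_min d0.
move=> q /=; rewrite inE => /orP[/eqP ->|hq]; first by rewrite ge_min lexx orbT.
by rewrite ge_min IH.
Qed.

Lemma ler_powR2 (R : realType) (a b r : R) : 0 <= r -> 0 < a -> a <= b ->
  a `^ r <= b `^ r.
Proof.
move=> r0 a0 ab; apply: ge0_ler_powR => //; rewrite nnegrE ltW //.
exact: lt_le_trans a0 ab.
Qed.

Section IrrationalityExponent.
Variables (R : realType) (x : R) (N : nat -> nat) (d C0 : nat).
Hypothesis hirr : irrational x.
Hypothesis N2 : forall m, (2 <= N m)%N.
Hypothesis NS : forall m, N m.+1 = (N m ^ d)%N.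
Hypothesis Nbig : forall G : nat, exists m0, forall m, (m0 <= m)%N -> (G <= N m)%N.

Local Notation NR m := ((N m)%:R : R).

(** [u / v] need not be reduced. [C0] is an allowance for the factors relating the value at b to the
    value at b^(d^m). *)
Definition good_approx m (E n : nat) (u v : int) :=
  [/\ v != 0, `|v|%:~R <= NR m ^+ E & `|v%:~R * x - u%:~R| * NR m ^+ n <= NR m ^+ C0].

Lemma NR2 m : 2 <= NR m.
Proof. by rewrite (ler_nat R 2). Qed.

Lemma NR1 m : 1 <= NR m.
Proof. by have := NR2 m; lra. Qed.

Lemma NR0 m : 0 < NR m.
Proof. by have := NR2 m; lra. Qed.

(** For the largest [m] with [N m ^ Z <= q] one has [q < N m.+1 ^ Z], which is [N m ^ (d * Z)]. Thus
    [j] takes finitely many values while [q] is unbounded, and finitely many thresholds in [m]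
    suffice. *)
Lemma N_pow_range (Z m0 q : nat) : (0 < Z)%N -> (N m0 ^ Z <= q)%N ->
  exists m j, [/\ (m0 <= m)%N, (Z <= j)%N, (j < d * Z)%N & (N m ^ j <= q < N m ^ j.+1)%N].
Proof.
move=> Z0 hq; pose p m := (m0 <= m)%N && (N m ^ Z <= q)%N.
have hex : exists m, p m by exists m0; rewrite /p leqnn.
have [m1 hm1] := Nbig q.+1.
have hbd m : p m -> (m <= m1)%N.
  move=> /andP[_ h]; rewrite leqNgt; apply/negP => /ltnW /hm1 h2.
  have := leq_trans h2 (leq_trans (leq_pexp2l (_ : 0 < N m)%N Z0) h).
  by rewrite ltnn => /(_ (ltnW (N2 m))).
case: (ex_maxnP hex hbd) => m /andP[hm hZ] hmax.
have q0 : (0 < q)%N by apply: leq_trans hZ; rewrite expn_gt0 (ltnW (N2 m)).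
exists m, (trunc_log (N m) q); have := trunc_log_bounds (N2 m) q0.
set j := trunc_log _ _ => /andP[h1 h2]; split=> //; last by rewrite h1.
  by rewrite -ltnS -(ltn_exp2l _ _ (N2 m)); apply: leq_ltn_trans h2.
have hlt : (q < N m ^ (d * Z))%N.
  rewrite ltnNge; apply/negP => h; have := hmax m.+1.
  by rewrite /p NS -expnM h (leq_trans hm) // ltnn => /(_ isT).
by rewrite -(ltn_exp2l _ _ (N2 m)); apply: leq_ltn_trans hlt.
Qed.

(** For r = p/q take an approximation u/v different from r with q |v x - u| < 1/2. As p v - u q is a
    nonzero integer, q |v| |x - r| > 1/2, which bounds q^(mu - 1) by 2 N^E. With q near N^j and E at
    most about lam j this fails when mu > 1 + lam and j is large. *)
Lemma exponent_le (lam K mu : R) : 1 <= lam ->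
  (forall n : nat, exists E : nat, E%:R <= lam * n%:R + K /\
    exists m0, forall m, (m0 <= m)%N -> exists u v u' v',
      [/\ good_approx m E n.+1 u v, good_approx m E n.+1 u' v' & u * v' != u' * v]) ->
  infinite_set [set r : rat | `|x - ratr r| < ((denq r)%:~R : R) `^ (- mu)] ->
  mu <= 1 + lam.
Proof.
move=> lam1 H hinf; rewrite leNgt; apply/negP => hmu; apply: hinf.
have mu1 : 1 < mu by lra.
(* From the final comparison E + 1 <= (j - 1) (mu - 1): with E <= lam (j + C0) + K it follows from j
   (mu - 1 - lam) >= lam C0 + K + mu. *)
pose K1 : R := `|lam * C0%:R + K| + 1 + mu.
have [Z0 hZ0] : exists Z0 : nat, K1 <= Z0%:R * (mu - 1 - lam).
  have e0 : 0 < mu - 1 - lam by lra.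
  exists (Num.bound `|K1 / (mu - 1 - lam)|); rewrite -ler_pdivrMr //.
  by apply: le_trans (ler_norm _) (ltW (archi_boundP (normr_ge0 _))).
pose Z := Z0.+1.
have hZ j : (Z <= j)%N -> K1 <= j%:R * (mu - 1 - lam).
  move=> hj; apply: le_trans hZ0 _; rewrite ler_wpM2r //; first by lra.
  by rewrite ler_nat ltnW.
pose W n m0 := exists E : nat, E%:R <= lam * n%:R + K /\
    forall m, (m0 <= m)%N -> exists u v u' v',
      [/\ good_approx m E n.+1 u v, good_approx m E n.+1 u' v' & u * v' != u' * v].
have [m0 hm0] := @uniform_bound (d * Z + C0) W
  (fun n k k' hk => fun '(ex_intro E (conj h1 h2)) =>
     ex_intro _ E (conj h1 (fun m hm => h2 m (leq_trans hk hm))))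
  (fun n _ => let: ex_intro E (conj h1 (ex_intro k h2)) := H n in
     ex_intro _ k (ex_intro _ E (conj h1 h2))).
apply: sub_finite_set (@finite_bounded_denq R x (N m0 ^ Z)) => r /= hr.
set q := denq r in hr *; have q0 : 0 < q := denq_gt0 r.
have q1 : 1 <= q%:~R :> R by rewrite (ler_int R 1); lia.
have hq1 : (q%:~R : R) `^ (- mu) <= 1.
  have := @ler_powR R q%:~R q1 (- mu) 0; rewrite powRr0; apply; lra.
split; first exact: ltW (lt_le_trans hr hq1).
rewrite leNgt; apply/negP => hq.
pose Q := `|q|%N; have qQ : q = Q%:Z by rewrite /Q; lia.
(* Bounding 2 Q rather than Q by a power of [N m] makes the error term smaller than 1/2. *)
have [||m [j [hm Zj jZ /andP[b1 b2]]]] := @N_pow_range Z m0 (2 * Q) => //.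
  by move: hq; rewrite qQ; lia.
have [|E [hE hW]] := hm0 (j + C0)%N; first by lia.
have [u [v [u' [v' [g g' ne]]]]] := hW m hm.
have [y [z [[z0 hz1 hz2] hyz]]] : exists y z, good_approx m E (j + C0).+1 y z /\
    numq r * z != y * q.
  have [e|] := eqVneq (numq r * v) (u * q); last by exists u, v.
  have [e'|] := eqVneq (numq r * v') (u' * q); last by exists u', v'.
  exfalso; move/eqP: ne; apply; apply: (@mulIf _ q); first by rewrite gt_eqF.
  by rewrite mulrAC -e mulrAC [RHS]mulrAC -e' mulrAC.
have qR : (q%:~R : R) = Q%:R by rewrite qQ.
have Q0 : 0 < Q%:R :> R by rewrite -qR; lra.
have key : 1 < 2 * `|z|%:~R * (Q%:R * `|x - ratr r|).
  have i1 : 1 <= `|(numq r * z - y * q)%:~R : R|.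
    by rewrite norm_intr_ge1 ?intr_int // intr_eq0 subr_eq0.
  have eq : (numq r * z - y * q)%:~R = z%:~R * Q%:R * (ratr r - x) + Q%:R * (z%:~R * x - y%:~R) :> R.
    have en : (numq r)%:~R = ratr r * Q%:R :> R.
      by rewrite -qR -(ratr_int R (denq r)) -rmorphM -numqE /= ratr_int.
    by rewrite intrB !intrM en qR; ring.
  have i2 : 2 * (Q%:R * `|z%:~R * x - y%:~R|) < 1.
    have NC := exprn_gt0 (j + C0).+1 (NR0 m).
    rewrite -(ltr_pM2r NC) mul1r.
    have -> : 2 * (Q%:R * `|z%:~R * x - y%:~R|) * NR m ^+ (j + C0).+1 =
      (2 * Q%:R) * (`|z%:~R * x - y%:~R| * NR m ^+ (j + C0).+1) by ring.
    apply: le_lt_trans (ler_wpM2l _ hz2) _; first by rewrite mulr_ge0 // ltW.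
    rewrite -addSn exprD ltr_pM2r ?exprn_gt0 ?NR0 //.
    by rewrite -natrM -natrX ltr_nat.
  have i3 : `|(numq r * z - y * q)%:~R : R| <=
      `|z|%:~R * (Q%:R * `|x - ratr r|) + Q%:R * `|z%:~R * x - y%:~R|.
    rewrite eq; apply: le_trans (ler_normD _ _) _.
    by rewrite !normrM (ger0_norm (ltW Q0)) intr_norm (distrC x) -!mulrA.
  by lra.
have hQ : Q%:R * `|x - ratr r| < (Q%:R : R) `^ (1 - mu).
  rewrite powRD; last by apply/implyP => _; rewrite gt_eqF.
  by rewrite powRr1 ?ltW // ltr_pM2l // -qR.
have big : (Q%:R : R) `^ (mu - 1) < 2 * NR m ^+ E.
  have p0 : 0 < (Q%:R : R) `^ (mu - 1) by rewrite powR_gt0.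
  have e1 : (Q%:R : R) `^ (mu - 1) * (Q%:R : R) `^ (1 - mu) = 1.
    rewrite -powRD; last by apply/implyP => _; rewrite gt_eqF.
    by rewrite (_ : mu - 1 + (1 - mu) = 0) ?powRr0 //; ring.
  have k1 : 1 < 2 * NR m ^+ E * (Q%:R : R) `^ (1 - mu).
    apply: lt_le_trans key _; apply: ler_pM.
    - by rewrite mulr_ge0 // ler0z.
    - by rewrite mulr_ge0 // ltW.
    - by rewrite ler_pM2l.
    - exact: ltW.
  by rewrite -(ltr_pM2r (powR_gt0 (1 - mu) Q0)) e1.
have j0 : (0 < j)%N by exact: leq_trans (ltn0Sn _) Zj.
have lowQ : NR m `^ (j%:R - 1) <= Q%:R.
  have -> : j%:R - 1 = j.-1%:R :> R by rewrite -subn1 natrB.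
  rewrite powR_mulrn ?ler0n // -natrX ler_nat.
  rewrite -(leq_pmul2l (_ : 0 < 2)%N) //; apply: leq_trans b1.
  by rewrite -{2}(prednK j0) expnS leq_mul2r N2 orbT.
have low : NR m `^ ((j%:R - 1) * (mu - 1)) <= (Q%:R : R) `^ (mu - 1).
  by rewrite powRrM; apply: ler_powR2; rewrite ?powR_gt0 ?NR0 //; lra.
have high : 2 * NR m ^+ E <= NR m `^ (E%:R + 1).
  rewrite powRD; last by apply/implyP => _; rewrite gt_eqF ?NR0.
  rewrite powRr1 ?(ltW (NR0 m)) // powR_mulrn ?(ltW (NR0 m)) // mulrC ler_pM2l ?NR2 //.
  by rewrite exprn_gt0 // NR0.
have lt1 := le_lt_trans low (lt_le_trans big high).
have : E%:R + 1 <= (j%:R - 1) * (mu - 1).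
  have h1 := hZ j Zj; have h2 := ler_norm (lam * C0%:R + K).
  move: hE; rewrite natrD => hE.
  have e1 : (j%:R - 1) * (mu - 1) = j%:R * (mu - 1 - lam) + lam * j%:R - mu + 1 by ring.
  have e2 : lam * (j%:R + C0%:R) = lam * j%:R + lam * C0%:R by ring.
  by rewrite e1; move: h1; rewrite /K1; lra.
by move=> /(ler_powR (NR1 m)); rewrite leNgt lt1.
Qed.

(** |x - u/v| |v|^mu is at most N^(E (mu - 1) + C0 - e) < 1, and reducing u/v only helps. A finite
    set of solutions would keep a positive distance from the irrational [x], while [C0 < e] makes
    the approximations tend to [x]. *)
Lemma exponent_ge (mu : R) : 1 <= mu ->
  (exists E e : nat, [/\ E%:R * (mu - 1) + C0%:R < e%:R, (C0 < e)%N &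
    exists m0, forall m, (m0 <= m)%N -> exists u v, good_approx m E e u v]) ->
  infinite_set [set r : rat | `|x - ratr r| < ((denq r)%:~R : R) `^ (- mu)].
Proof.
move=> mu1 [E [e [hE he [m0 hm0]]]] hfin.
have [del del0 hdel] := finite_dist_pos hirr hfin.
have [m1 hm1] := Nbig (Num.bound del^-1).
pose m := maxn m0 m1; have [u [v [v0 h1 h2]]] := hm0 m (leq_maxl _ _).
pose r : rat := u%:~R / v%:~R.
have vR : 1 <= `|v|%:~R :> R by rewrite (ler_int R 1); lia.
have v0' : (v%:~R : R) != 0 by rewrite intr_eq0.
have er : `|x - ratr r| * `|v|%:~R = `|v%:~R * x - u%:~R|.
  have eqr : ratr r = u%:~R / v%:~R :> R by rewrite /r fmorph_div /= !ratr_int.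
  rewrite intr_norm -normrM eqr; congr `|_|.
  by field.
have hNm := exprn_gt0 e (NR0 m).
have small : `|v%:~R * x - u%:~R| <= NR m ^+ C0 / NR m ^+ e by rewrite ler_pdivlMr.
have hr : [set r : rat | `|x - ratr r| < ((denq r)%:~R : R) `^ (- mu)] r.
  rewrite /=; have dr : (denq r)%:~R <= `|v|%:~R :> R by rewrite ler_int denq_divq_le.
  have dr0 : 0 < (denq r)%:~R :> R by rewrite ltr0z denq_gt0.
  have vp : 0 < `|v|%:~R :> R by lra.
  apply: (@lt_le_trans _ _ (`|v|%:~R `^ (- mu))); last first.
    rewrite !powRN lef_pV2 ?posrE ?powR_gt0 //.
    by apply: ler_powR2 => //; lra.
  rewrite powRN -[X in _ < X]mul1r ltr_pdivlMr ?powR_gt0 //.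
  have -> : mu = 1 + (mu - 1) by ring.
  rewrite powRD; last by apply/implyP => _; rewrite gt_eqF.
  rewrite powRr1 ?ltW // mulrA er.
  apply: (@le_lt_trans _ _ (NR m ^+ C0 / NR m ^+ e * NR m `^ (E%:R * (mu - 1)))).
    apply: ler_pM; rewrite ?powR_ge0 //.
    rewrite powRrM powR_mulrn ?(ltW (NR0 m)) //.
    by apply: ler_powR2 => //; lra.
  rewrite mulrAC ltr_pdivrMr // mul1r -!powR_mulrn ?(ltW (NR0 m)) //.
  rewrite -powRD; last by apply/implyP => _; rewrite gt_eqF ?NR0.
  have N1 : 1 < NR m by have := NR2 m; lra.
  rewrite /powR !gt_eqF ?NR0 // ltr_expR ltr_pM2r ?ln_gt0 //.
  by rewrite addrC.
have := hdel _ hr; rewrite leNgt => /negP; apply.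
have le1 : `|x - ratr r| <= `|v%:~R * x - u%:~R|.
  by rewrite -er ler_peMr.
apply: le_lt_trans le1 _; apply: le_lt_trans small _.
have le2 : NR m ^+ C0 / NR m ^+ e <= (NR m)^-1.
  rewrite ler_pdivrMr // mulrC ler_pdivlMr ?NR0 // -exprSr.
  by rewrite ler_weXn2l // NR1.
apply: le_lt_trans le2 _; rewrite invf_plt ?posrE ?NR0 //.
apply: lt_le_trans (archi_boundP _) _; first by rewrite invr_ge0 ltW.
by rewrite ler_nat hm1 // leq_maxr.
Qed.
End IrrationalityExponent.

(** * Mahler numbers *)

Lemma good_approx_weaken (R : realType) (x : R) (N : nat -> nat) C0 m E n E' n' u v :
  (0 < N m)%N -> (E <= E')%N -> (n' <= n)%N ->
  good_approx x N C0 m E n u v -> good_approx x N C0 m E' n' u v.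
Proof.
move=> N0 hE hn [v0 h1 h2]; have N1 : 1 <= (N m)%:R :> R by rewrite (ler_nat R 1).
split=> //; first by apply: le_trans h1 _; rewrite ler_weXn2l.
by apply: le_trans h2; rewrite ler_wpM2l // ler_weXn2l.
Qed.

Lemma evalR_bound (R : realType) (P : {poly rat}) : exists2 H : R, 0 <= H &
  forall x : R, 1 <= `|x| -> `|evalR P x| <= H * `|x| ^+ deg P.
Proof.
exists (\sum_(i < size P) `|ratr P`_i|) => [|x x1]; first by rewrite sumr_ge0.
rewrite /evalR horner_coef size_map_poly mulr_suml.
apply: le_trans (ler_norm_sum _ _ _) _; apply: ler_sum => i _.
rewrite coef_map /= normrM normrX ler_wpM2l // ler_weXn2l //.
by rewrite /deg -ltnS (leq_trans (ltn_ord i)) // leqSpred.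
Qed.

Lemma evalR_rat (R : realType) (P : {poly rat}) (x : rat) :
  evalR P (ratr x : R) = ratr P.[x].
Proof. by rewrite /evalR horner_map. Qed.

Lemma eventually_not_root (P : {poly rat}) (o : nat -> rat) : P != 0 -> injective o ->
  exists m0, forall m, (m0 <= m)%N -> P.[o m] != 0.
Proof.
move=> P0 inj; have [W eW] := closed_field_poly_normal (map_poly (ratr : rat -> algC) P).
have inj' : injective (fun m => ratr (o m) : algC).
  by move=> m n /fmorph_inj /inj.
have [m0 hm0] := orbit_leaves_seq W inj'; exists m0 => m /hm0.
apply: contraNneq => e; rewrite -root_prod_XsubC -(@rootZ _ _ (lead_coef (map_poly ratr P))).
  by rewrite -eW rootE horner_map e rmorph0.
by rewrite lead_coef_eq0 map_poly_eq0.
Qed.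

(** Since [M m.+1 = M m ^+ d] with [d >= 2], the bound [M m ^+ a.+1] is at least squared at each
    step, which absorbs the new factor; one more power of [M m] absorbs the constant [G]. *)
Lemma cocycle_bound (R : realType) (d a : nat) (w g M : nat -> R) (H : R) :
  (1 < d)%N -> 0 <= H -> (forall m, 1 <= M m) -> (forall m, M m.+1 = M m ^+ d) ->
  (forall G : R, exists m0, forall m, (m0 <= m)%N -> G <= M m) ->
  (forall m, w m.+1 = w m * g m) -> (forall m, `|g m| <= H * M m ^+ a) ->
  exists m0, forall m, (m0 <= m)%N -> `|w m| <= M m ^+ a.+2.
Proof.
move=> d1 H0 M1 MS Mbig wS hg; have M0 m : 0 <= M m by apply: le_trans (M1 m).
have [m1 hm1] := Mbig H; set G := `|w m1|; have G0 : 0 <= G := normr_ge0 _.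
have key k : `|w (m1 + k)%N| <= G * M (m1 + k)%N ^+ a.+1.
  elim: k => [|k IH]; first by rewrite addn0 ler_peMr // exprn_ege1.
  rewrite addnS wS normrM MS -exprM; set m := (m1 + k)%N in IH *.
  have hm : H <= M m by apply: hm1; rewrite leq_addr.
  have hg' : `|g m| <= M m ^+ a.+1.
    by apply: le_trans (hg m) _; rewrite exprS ler_wpM2r // exprn_ge0.
  apply: le_trans (ler_pM _ _ IH hg') _ => //.
  rewrite -mulrA ler_wpM2l // -exprD ler_weXn2l //.
  by rewrite addnn -mul2n leq_mul2r d1 orbT.
have [m2 hm2] := Mbig G; exists (maxn m1 m2) => m; rewrite geq_max => /andP[h1 h2].
have := key (m - m1)%N; rewrite subnKC // => h; apply: le_trans h _.
by rewrite [M m ^+ a.+2]exprS ler_wpM2r ?exprn_ge0 // hm2.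
Qed.

Section MainTheorem.
Variables (R : realType) (d : nat) (A B : {poly rat}) (f : laurent) (b : int).
Hypotheses (d2 : (1 < d)%N) (B0 : B != 0) (hf : mahler_eq d A B f).
Hypothesis hb : in_convergence_domain f (b%:~R : R).
Hypothesis hAB : forall m : nat,
  A.[(b ^+ (d ^ m)%N)%:~R] * B.[(b ^+ (d ^ m)%N)%:~R] != 0.
Hypothesis hirr : irrational (leval f (b%:~R : R)).

Local Notation xi := (leval f (b%:~R : R)).
Let c := lcoef f.
Let T : int := (size (lpoly f))%:Z.
Let y m : rat := (b ^+ (d ^ m)%N)%:~R.
Let N m : nat := (`|b| ^ (d ^ m))%N.

Let Ay0 m : A.[y m] != 0.
Proof. by have := hAB m; rewrite mulf_eq0 negb_or => /andP[]. Qed.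

Let By0 m : B.[y m] != 0.
Proof. by have := hAB m; rewrite mulf_eq0 negb_or => /andP[]. Qed.

Let A0 : A != 0.
Proof. by apply: contraNneq (Ay0 0) => ->; rewrite horner0. Qed.

Let b0 : b != 0.
Proof.
have [r [r0 rb _]] := hb; apply: contraTneq rb => ->.
by rewrite normr0 -leNgt.
Qed.

Let cT : lbd c T. Proof. exact: lbd_lcoef. Qed.

Let normy m : `|ratr (y m)| = (N m)%:R :> R.
Proof.
rewrite /y ratr_int -intr_norm normrX /N -[(_ ^ _)%:R]/((_ ^ _)%N%:Z%:~R); congr _%:~R.
by rewrite -abszE; elim: (d ^ m)%N => // k IH; rewrite exprS IH expnS PoszM.
Qed.

Let yneq0 m : (ratr (y m) : R) != 0.
Proof. by rewrite fmorph_eq0 /y intr_eq0 expf_neq0. Qed.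

Let evF m : has_eval c (ratr (y m) : R) (leval f (ratr (y m) : R)).
Proof.
apply: has_eval_leval => //; have [r [r0 rb h]] := hb; apply: h.
apply: lt_le_trans rb _; rewrite normy -intr_norm -abszE.
rewrite -[(_)%:~R]/((`|b|%N)%:R) ler_nat /N.
have b1 : (0 < `|b|)%N by rewrite absz_gt0.
by rewrite -{1}(expn1 `|b|%N) leq_pexp2l // expn_gt0 ltnW.
Qed.

Let xiE : xi = leval f (ratr (y 0) : R).
Proof. by rewrite /y expn0 expr1 ratr_int. Qed.

Let cirr : forall P Q : {poly rat}, P != 0 -> ~ (forall n, lmulp P c n = polyL Q n).
Proof.
apply: (@not_rational_function R c b xi T) => //.
by have := evF 0; rewrite -xiE /y expn0 expr1 ratr_int.
Qed.

Let b2 : (2 <= `|b|)%N.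
Proof.
have [rho /andP[r0 rb] hg] := lgrowth_lcoef hb.
rewrite ltnNge; apply/negP => b1.
have := @no_small_radius R d A B c T d2 A0 B0 hf cT cirr rho; apply=> //.
rewrite r0; apply: lt_le_trans rb _.
by rewrite -intr_norm -abszE -[(_)%:~R]/((`|b|%N)%:R) (ler_nat R _ 1).
Qed.

Let N2 m : (2 <= N m)%N.
Proof.
apply: leq_trans b2 _; rewrite -{1}(expn1 `|b|%N) leq_pexp2l ?(ltnW b2) //.
by rewrite expn_gt0 ltnW.
Qed.

Let NS m : N m.+1 = (N m ^ d)%N.
Proof. by rewrite /N expnSr expnM. Qed.

Let Nbig G : exists m0, forall m, (m0 <= m)%N -> (G <= N m)%N.
Proof.
exists G => m hm; apply: leq_trans hm _; rewrite ltnW //.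
apply: leq_trans (ltn_expl m d2) _; apply: ltnW.
exact: ltn_expl.
Qed.

Let NbigR (G : R) : exists m0, forall m, (m0 <= m)%N -> G <= (N m)%:R.
Proof.
have [m0 h] := Nbig (Num.bound `|G|); exists m0 => m /h hm.
apply: le_trans (ler_norm _) _; apply: le_trans (ltW (archi_boundP _)) _ => //.
by rewrite ler_nat.
Qed.

Let N1 m : 1 <= (N m)%:R :> R.
Proof. by rewrite (ler_nat R 1) ltnW. Qed.

Let yinj : injective y.
Proof.
move=> m n /(congr1 (fun q => `|ratr q : R|)); rewrite !normy => /eqP.
by rewrite eqr_nat eqn_exp2l // eqn_exp2l // => /eqP.
Qed.

Lemma functional_eq_eval m :
  ratr B.[y m] * leval f (ratr (y m) : R) = ratr A.[y m] * leval f (ratr (y m.+1) : R).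
Proof.
rewrite -!evalR_rat; apply: (@has_eval_uniq R (lmulp B c) (ratr (y m))).
  exact: has_eval_lmulp.
apply: (@eq_has_eval R (lmulp A (coef_comp_Xn d c))) => [n|]; first by rewrite hf.
apply: has_eval_lmulp => //; apply: has_eval_comp => //; first exact: ltnW.
have -> : ratr (y m) ^+ d = ratr (y m.+1) :> R.
  by rewrite -rmorphXn /y -rmorphXn /= -exprM expnSr.
exact: evF.
Qed.

(** For the products w, w' of multiples of A and B over the points y t with t < m, w' xi = w f(y m),
    so v xi - u = s w (P f - Q)(y m). The formulas for [u] and [v] belong to the conclusion because
    determinants of two approximations are computed from them. *)
Lemma good_approx_ex : exists (C0 : nat) (w w' : nat -> rat),
  (forall m, w m != 0 /\ w' m != 0) /\
  forall P Q e, P != 0 -> lbd (resid c P Q) (- e%:Z) ->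
  exists2 s : rat, s != 0 & exists m0, forall m, (m0 <= m)%N -> exists u v : int,
    [/\ u%:~R = s * w m * Q.[y m], v%:~R = s * w' m * P.[y m] &
        good_approx xi N C0 m (deg P + C0) e u v].
Proof.
have [hA hA0 iA] := rat_poly_int_multiple A; have [hB hB0 iB] := rat_poly_int_multiple B.
(* The same multiplier for [A] and [B] leaves A/B unchanged; [s] does this for [P] and [Q]. *)
pose h : rat := (hA * hB)%:~R.
have h0 : h != 0 by rewrite intr_eq0 mulf_neq0.
have yint m : y m \is a Num.int by rewrite intr_int.
have iA' m : (h *: A).[y m] \is a Num.int.
  apply: rpred_horner => //; rewrite /h mulrC intrM -scalerA polyOverZ ?intr_int //.
have iB' m : (h *: B).[y m] \is a Num.int.
  apply: rpred_horner => //; rewrite /h intrM -scalerA polyOverZ ?intr_int //.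
pose w m := \prod_(t < m) (h *: A).[y t]; pose w' m := \prod_(t < m) (h *: B).[y t].
have w0 m : w m != 0.
  by apply/prodf_neq0 => t _; rewrite hornerZ mulf_neq0.
have w0' m : w' m != 0.
  by apply/prodf_neq0 => t _; rewrite hornerZ mulf_neq0.
have iw m : w m \is a Num.int by apply: rpred_prod.
have iw' m : w' m \is a Num.int by apply: rpred_prod.
have wxi m : ratr (w' m) * xi = ratr (w m) * leval f (ratr (y m) : R).
  elim: m => [|m IH]; first by rewrite /w /w' !big_ord0 !rmorph1 !mul1r xiE.
  rewrite /w /w' !big_ord_recr /= -/(w m) -/(w' m) !rmorphM /= mulrAC IH.
  rewrite !hornerZ !rmorphM /=.
  have := functional_eq_eval m; set FF := leval f _; set GG := leval f _ => e.
  have -> : ratr (w m) * FF * (ratr h * ratr B.[y m]) =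
     ratr (w m) * ratr h * (ratr B.[y m] * FF) :> R by ring.
  by rewrite e; ring.
have bnd (P : {poly rat}) (v : nat -> rat) : (forall m, v m.+1 = v m * P.[y m]) ->
    exists m0, forall m, (m0 <= m)%N -> `|ratr (v m) : R| <= (N m)%:R ^+ (deg P).+2.
  move=> vS; have [H H0 hH] := evalR_bound R P.
  apply: (@cocycle_bound R d (deg P) _ (fun m => ratr P.[y m]) _ H) => //.
  - by move=> m; rewrite NS natrX.
  - by move=> m; rewrite vS rmorphM.
  - by move=> m; rewrite -evalR_rat -normy; apply: hH; rewrite normy.
have [ma hma] : exists m0, forall m, (m0 <= m)%N ->
    `|ratr (w m) : R| <= (N m)%:R ^+ (deg (h *: A)).+2.
  by apply: bnd => m; rewrite /w big_ord_recr.
have [mb hmb] : exists m0, forall m, (m0 <= m)%N ->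
    `|ratr (w' m) : R| <= (N m)%:R ^+ (deg (h *: B)).+2.
  by apply: bnd => m; rewrite /w' big_ord_recr.
(* Each product costs its degree plus 2 by [cocycle_bound]; one more power of [N m] absorbs the
   constants |s| M and |s| H. *)
exists (deg (h *: A) + deg (h *: B) + 3)%N, w, w'; split=> // P Q e P0 hlbd.
have [sP sP0 iP] := rat_poly_int_multiple P; have [sQ sQ0 iQ] := rat_poly_int_multiple Q.
pose s : rat := (sP * sQ)%:~R.
have s0 : s != 0 by rewrite intr_eq0 mulf_neq0.
exists s => //.
have iP' m : s * P.[y m] \is a Num.int.
  rewrite -hornerZ; apply: rpred_horner => //.
  by rewrite /s mulrC intrM -scalerA polyOverZ ?intr_int.
have iQ' m : s * Q.[y m] \is a Num.int.
  rewrite -hornerZ; apply: rpred_horner => //.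
  by rewrite /s intrM -scalerA polyOverZ ?intr_int.
have [rho hrho hg] := lgrowth_lcoef hb.
have hres : lgrowth rho (resid c P Q).
  by apply: lgrowthB; [apply: lgrowth_lmulp|apply: lgrowth_polyL]; rewrite // ltW //; case/andP: hrho.
have [M hM] := has_eval_bound hres hrho hlbd.
have [H H0 hH] := evalR_bound R P.
have [m1 hm1] := NbigR (`|ratr s| * M); have [m2 hm2] := NbigR (`|ratr s| * H).
have [m3 hm3] := eventually_not_root P0 yinj.
exists (maxn (maxn ma mb) (maxn m1 (maxn m2 m3))) => m.
rewrite !geq_max => /andP[/andP[/hma ka /hmb kb] /and3P[/hm1 k1 /hm2 k2 /hm3 k3]].
have /intrP[u hu] : s * w m * Q.[y m] \is a Num.int by rewrite mulrAC rpredM.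
have /intrP[v hv] : s * w' m * P.[y m] \is a Num.int by rewrite mulrAC rpredM.
have uR : u%:~R = ratr s * ratr (w m) * ratr Q.[y m] :> R.
  by rewrite -ratr_int -hu !rmorphM.
have vR : v%:~R = ratr s * ratr (w' m) * ratr P.[y m] :> R.
  by rewrite -ratr_int -hv !rmorphM.
have N0 k : 0 <= (N m)%:R ^+ k :> R by rewrite exprn_ge0.
exists u, v; split=> //; split.
- by rewrite -(intr_eq0 rat) -hv !mulf_neq0.
- rewrite intr_norm vR 2!normrM -mulrA mulrCA.
  have kP : `|ratr P.[y m] : R| <= H * (N m)%:R ^+ deg P.
    by rewrite -evalR_rat -normy; apply: hH; rewrite normy.
  apply: (@le_trans _ _ ((N m)%:R ^+ (deg (h *: B)).+2 * ((N m)%:R * (N m)%:R ^+ deg P))).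
    apply: ler_pM; rewrite ?mulr_ge0 //.
    apply: le_trans (ler_wpM2l (normr_ge0 _) kP) _.
    by rewrite mulrA ler_wpM2r.
  by rewrite -exprS -exprD ler_weXn2l // !addSn !addnS addn0 !ltnS addnC leq_add2l leq_addl.
have hval : has_eval (resid c P Q) (ratr (y m) : R)
    (ratr P.[y m] * leval f (ratr (y m) : R) - ratr Q.[y m]).
  by rewrite -!evalR_rat; apply: has_eval_resid.
have hby : `|b%:~R : R| <= `|ratr (y m)|.
  rewrite normy -intr_norm -abszE -[(_)%:~R]/((`|b|%N)%:R) ler_nat /N.
  by rewrite -{1}(expn1 `|b|%N) leq_pexp2l ?(ltnW b2) // expn_gt0 ltnW.
have := hM _ _ hby hval; rewrite normy => hM'.
have -> : v%:~R * xi - u%:~R = ratr s * ratr (w m) *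
    (ratr P.[y m] * leval f (ratr (y m) : R) - ratr Q.[y m]).
  rewrite uR vR; have := wxi m; set W' := ratr (w' m); set W := ratr (w m).
  set FF := leval f (ratr (y m)) => e1.
  have -> : ratr s * W' * ratr P.[y m] * xi = ratr s * ratr P.[y m] * (W' * xi) :> R by ring.
  by rewrite e1; ring.
set X := ratr P.[y m] * _ - _ in hM' *.
rewrite (normrM _ X) (normrM (ratr s)) -mulrA mulrCA -!mulrA.
apply: (@le_trans _ _ ((N m)%:R ^+ (deg (h *: A)).+2 * (N m)%:R)).
  apply: ler_pM; rewrite ?mulr_ge0 //.
  by apply: le_trans (ler_wpM2l (normr_ge0 _) hM') _.
by rewrite -exprSr ler_weXn2l // !addnS addn0 !ltnS leq_addr.
Qed.

Lemma irrationality_exponent_rational :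
  exists r : rat, irrationality_exponent xi = (ratr r : R)%:E.
Proof.
have [r [K [r1 hlow hup]]] := convergent_ratio d2 A0 B0 hf cT cirr.
have [C0 [w [w' [w0 hga]]]] := good_approx_ex.
have lam1 : 1 <= ratr r :> R by rewrite -(rmorph1 ratr) ler_rat.
have lbdc P Q e : convergent c P Q e -> P != 0 /\ lbd (resid c P Q) (- e%:Z).
  by move=> [P0 _ [_ hl] _].
exists (1 + r); rewrite rmorphD rmorph1 /=; apply/le_anti/andP; split.
  apply: ge_ereal_sup => _ [mu hmu <-]; rewrite lee_fin.
  apply: (exponent_le N2 NS Nbig (K := ratr K + C0%:R) lam1 _ hmu) => n.
  have [P [Q [e [hc h1 h2]]]] := convergent_ex cT cirr n.
  (* Taken around [e], the second convergent has deg P' <= e < e': its denominator still fits the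
     bound [E], and since the orders differ the determinant is a nonzero polynomial. *)
  have [P' [Q' [e' [hc' h1' h2']]]] := convergent_ex cT cirr e.
  exists (e + C0)%N; split.
    rewrite natrD addrA lerD2r; have := hup _ _ _ hc.
    rewrite -(ler_rat R) rmorphD rmorphM /= !ratr_nat => h; apply: le_trans h _.
    by rewrite lerD2r ler_wpM2l ?ler_nat //; apply: le_trans lam1.
  have [P0 hl] := lbdc _ _ _ hc; have [P0' hl'] := lbdc _ _ _ hc'.
  have [s s0 [m0 hm0]] := hga P Q e P0 hl; have [s' s0' [m0' hm0']] := hga P' Q' e' P0' hl'.
  have D0 : Q * P' - Q' * P != 0.
    rewrite subr_eq0; apply/eqP => eq; have [_ ee] : deg P = deg P' /\ e = e'.
      by apply: (convergent_cross hc hc'); rewrite mulrC -eq mulrC.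
    by move: h2'; rewrite ee ltnn.
  have [m1 hm1] := eventually_not_root D0 yinj.
  exists (maxn m0 (maxn m0' m1)) => m; rewrite !geq_max => /and3P[k0 k0' k1].
  have [u [v [eu ev g]]] := hm0 m k0; have [u' [v' [eu' ev' g']]] := hm0' m k0'.
  exists u, v, u', v'; split.
  - by apply: good_approx_weaken g; rewrite ?leq_add2r //; [rewrite ltnW|rewrite (leq_trans h1) // ltnW].
  - by apply: good_approx_weaken g'; rewrite ?leq_add2r //; [rewrite ltnW|rewrite (leq_trans h2) // ltnW].
  rewrite -(inj_eq (@intr_inj rat)) !intrM eu ev eu' ev' -subr_eq0.
  have -> : s * w m * Q.[y m] * (s' * w' m * P'.[y m]) -
    s' * w m * Q'.[y m] * (s * w' m * P.[y m]) =
    s * s' * w m * w' m * (Q * P' - Q' * P).[y m].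
    by rewrite hornerD hornerN !hornerM; ring.
  by have [? ?] := w0 m; rewrite !mulf_neq0 // hm1.
apply/lee_subgt0Pr => eps eps0.
(* [exponent_ge] wants an exponent at least 1; the maximum still lies below 1 + r because r >= 1. *)
pose mu : R := Num.max 1 (1 + ratr r - eps).
have mu1 : 1 <= mu by rewrite le_max lexx.
have mulam : mu < 1 + ratr r by rewrite gt_max; apply/andP; split; lra.
have mueps : 1 + ratr r - eps <= mu by rewrite le_max lexx orbT.
apply: (@le_trans _ _ mu%:E); first by rewrite lee_fin.
apply: ereal_sup_ubound; exists mu => //=.
apply: (exponent_ge (C0 := C0) hirr N2 Nbig mu1).
pose del : R := 1 + ratr r - mu; have del0 : 0 < del by rewrite /del; lra.
(* As e >= r deg P - K, the inequality (deg P + C0) (mu - 1) + C0 < e follows once deg P times [del]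
   exceeds [V]. *)
pose V : R := C0%:R * (mu - 1) + C0%:R + ratr K.
have [P [Q [e [hc hY he]]]] := hlow (Num.bound (`|V / del|)).
exists (deg P + C0)%N, e.
have main : (deg P + C0)%:R * (mu - 1) + C0%:R < e%:R.
  move: he; rewrite -(ler_rat R) rmorphB rmorphM /= !ratr_nat => he.
  apply: lt_le_trans he; rewrite natrD.
  have hV : V < (deg P)%:R * del.
    rewrite -ltr_pdivrMr //; apply: le_lt_trans (ler_norm _) _.
    by apply: lt_le_trans (archi_boundP (normr_ge0 _)) _; rewrite ler_nat.
  move: hV; rewrite /V /del; move: (ratr K) (ratr r) (deg P)%:R => k l n hV; lra.
split=> //.
  rewrite -(ltr_nat R); apply: le_lt_trans main; rewrite lerDr mulr_ge0 // subr_ge0 //.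
have [P0 hl] := lbdc _ _ _ hc; have [s s0 [m0 hm0]] := hga P Q e P0 hl.
by exists m0 => m /hm0 [u [v [_ _ g]]]; exists u, v.
Qed.
End MainTheorem.

Theorem theorem1 (R : realType) (d : nat) (A B : {poly rat}) (f : laurent)
    (b : int) (hd : (2 <= d)%N) (hB : B != 0) (hf : mahler_eq d A B f)
    (hb : in_convergence_domain f (b%:~R : R))
    (hAB : forall m : nat,
      A.[(b ^+ (d ^ m)%N)%:~R] * B.[(b ^+ (d ^ m)%N)%:~R] != 0)
    (hirr : irrational (leval f (b%:~R : R))) :
  exists r : rat,
    irrationality_exponent (leval f (b%:~R : R)) = (ratr r : R)%:E.
Proof. exact: (irrationality_exponent_rational hd hB hf hb hAB hirr). Qed.
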